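(* Fix an integer $\Delta\ge 3$ and a real $\varepsilon>0$. Let $G$ be a connected $n$-vertex $\Delta$-regular graph with $\lambda(G)\le \Delta-\varepsilon$, and fix $u\in V(G)$. Then $\mathbb{E}(T(G,u)) \le O_{\Delta,\varepsilon}(\sqrt{n})$, where $T(G,u)$ is the self-intersection time of the non-backtracking random walk on $G$ started at $u$. That is, there is a constant $C$ depending only on $\Delta$ and $\varepsilon$ such that $\mathbb{E}(T(G,u))\le C\sqrt n$ for every such $n$, $G$ and $u$.
   Context: Graphs are finite, simple and undirected. For a $\Delta$-regular graph $G$ with adjacency matrix $A_G$, $\lambda(G):=\max\{|\lambda| : \lambda\in \mathrm{Spec}(A_G),\ |\lambda|\ne\Delta\}$, where $\mathrm{Spec}(A_G)$ is the set of eigenvalues of $A_G$ (so both $\Delta$ and $-\Delta$ are excluded; $G$ may be bipartite). For a connected graph $G$ with minimum degree at least $3$, the non-backtracking random walk (NBW) on $G$ from $u\in V(G)$ is the random process $(X_t)_{t\ge 0}$ with $X_0=u$, where $X_1$ is chosen uniformly from the set $N(X_0)$ of neighbours of $X_0$, and, for each $t\ge 2$, $X_t$ is chosen uniformly from $N(X_{t-1})\setminus\{X_{t-2}\}$ (conditionally on the past). The self-intersection time is $T(G,u):=\min\{t\ge 2 : X_t=X_j \text{ for some } j\in\{0,\ldots,t-1\}\}$. *)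

(* Defs.v *)
From HB Require Import structures.
From mathcomp Require Import all_boot all_order all_algebra.
From mathcomp Require Import all_classical all_reals all_analysis.

Set Implicit Arguments.
Unset Strict Implicit.
Unset Printing Implicit Defensive.

Import Order.TTheory GRing.Theory Num.Theory.

Local Open Scope classical_set_scope.
Local Open Scope ring_scope.

Record sgraph (V : finType) := SGraph {
  adj :> rel V;
  adj_sym : symmetric adj;
  adj_irr : irreflexive adj }.

Definition nbhd (V : finType) (G : sgraph V) (v : V) : {set V} :=
  [set w | G v w]%SET.

Definition connected_graph (V : finType) (G : sgraph V) : Prop :=
  forall v w : V, connect G v w.

Definition regular_graph (V : finType) (G : sgraph V) (k : nat) : Prop :=
  forall v : V, #|nbhd G v| = k.

Definition adj_matrix (R : realType) (V : finType) (G : sgraph V) :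
    'M[R]_#|V| :=
  \matrix_(i, j) (G (enum_val i) (enum_val j))%:R.

(* The adjacency matrix is symmetric, so all its eigenvalues are in R.  The set
   below is finite, and nonempty for connected k-regular graphs with k >= 3, so
   its supremum is a maximum. *)
Definition second_eigenvalue (R : realType) (V : finType) (G : sgraph V)
    (k : nat) : R :=
  sup [set `|a| | a in
        [set a : R | eigenvalue (adj_matrix R G) a /\ `|a| != k%:R]].

(* The vertices allowed at time t.+1 after the trajectory h 0, ..., h t. *)
Definition nbw_choices (V : finType) (G : sgraph V) (h : nat -> V) (t : nat) :
    {set V} :=
  if t is s.+1 then nbhd G (h s.+1) :\ h s else nbhd G (h 0%N).

Definition uniform_on (R : realType) (V : finType) (A : {set V}) (v : V) : R :=
  (v \in A)%:R / #|A|%:R.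

Definition past (Omega : Type) (V : finType) (X : nat -> Omega -> V)
    (h : nat -> V) (t : nat) : set Omega :=
  [set w | forall s, (s <= t)%N -> X s w = h s].

(* Each X t is a random variable with values in the finite set V, all of whose
   subsets are measurable.  The conditional law of X t.+1 given the past is
   stated in product form, which also covers pasts of probability 0. *)
Record is_nbw (R : realType) (V : finType) (G : sgraph V) (u : V)
    (d : measure_display) (Omega : measurableType d) (P : probability Omega R)
    (X : nat -> Omega -> V) : Prop := IsNBW {
  nbw_measurable : forall t (v : V), measurable [set w | X t w = v];
  nbw_start : P [set w | X 0%N w = u] = 1%E;
  nbw_step : forall (h : nat -> V) (t : nat),
    P (past X h t.+1)
    = (P (past X h t) * (uniform_on R (nbw_choices G h t) (h t.+1))%:E)%E }.

(* The infimum of the empty set is +oo. *)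
Definition self_intersection_time (R : realType) (Omega : Type) (V : finType)
    (X : nat -> Omega -> V) (w : Omega) : \bar R :=
  ereal_inf [set (t%:R : R)%:E | t in
    [set t : nat | (2 <= t)%N /\ exists2 j : nat, (j < t)%N & X t w = X j w]].

(* Main.v *)
Require Import Defs.
From HB Require Import structures.
From mathcomp Require Import all_boot all_order all_algebra.
From mathcomp Require Import all_classical all_reals all_analysis.
From mathcomp Require Import measurable_realfun.
From mathcomp Require Import spectral complex.
From mathcomp Require Import ring lra zify.

Set Implicit Arguments.
Unset Strict Implicit.
Unset Printing Implicit Defensive.

Import Order.TTheory GRing.Theory Num.Theory.

Local Open Scope classical_set_scope.
Local Open Scope ring_scope.

(** Write d for the degree, q = d - 1 and n for the number of vertices. The
    idea is a second moment argument on blocks of length of order sqrt n: after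
    any past, the walk crosses its own recent trajectory within the next block
    with probability bounded below, so that the time of the first
    self-intersection, counted in blocks, has a geometric tail.

    Fix a current directed edge and look at the next 6 L steps, with L of order
    sqrt n. Let N count the pairs (i, k) with i, k < L such that the walk is at
    the same vertex at times 2 i and 4 L + 2 k. All these time differences are
    even, so the possible bipartiteness of the graph is harmless, and they
    exceed 2 L, so the walk has mixed in between: each pair is a coincidence
    with probability at least 1 / (2 n) ([crossing_mean]) and the mean of N is
    of order L ^ 2 / n. For the second moment, consider two pairs whose early
    times differ by b and whose late times differ by c. Between the late and
    early times the walk has mixed, which gives a factor O(1 / n), and what
    remains is the probability that two short pieces of walk, of lengths b and
    c, starting at the same vertex have the same end. That probability is at
    most O(1 / n + tau ^ (b + c)) for some tau < 1, because each of the two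
    pieces can be used to bound it ([sum_hit_kernel]). The decay in both b and
    c makes the sum over all pairs of pairs of order (L ^ 2 / n) ^ 2, without a
    logarithm ([crossings_second_moment]). Since the indicator of N > 0 is at
    least 2 lam N - lam ^ 2 N ^ 2 for every lam, N > 0 has probability bounded
    below ([block_uniq_ub]).

    The estimates on transition probabilities are spectral. The number of
    non-backtracking walks of length k between two vertices is a polynomial of
    degree k in the adjacency matrix ([nbw_kernel_expansion]). At the
    eigenvalues d and - d the polynomial is of size q ^ k, but these
    eigenvalues together carry a mass between 1 / n and 2 / n at each vertex
    ([extremal_mass_lb], [extremal_mass_ub]). At the other eigenvalues, the
    polynomials satisfy, once divided by q ^ k, a recurrence which a quadratic
    Lyapunov function shows to be contracting at a rate that depends only on d
    and on the spectral gap ([nbw_poly_decay]). The conditional law of the walk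
    given its last edge is not such a polynomial, but it is squeezed between
    expressions in these polynomials: forbidding the immediate return only
    removes walks, and what it removes is controlled ([nbw_hit_le],
    [nbw_return_lb]).

    These statements are about finite sums over paths. They are transferred to
    the probability space through the law of cylinder events
    ([cylinder_conditional]), and the expectation is the sum of the tail
    probabilities ([expected_self_intersection_time]). *)

(** * Real spectral decomposition of symmetric matrices *)

(** Over the complex numbers a real symmetric matrix is diagonalised by a
    unitary matrix and its eigenvalues are real, so the real and the imaginary
    parts of each row of that matrix are again eigenvectors. Indexing by rows
    and a boolean gives twice too many vectors for a basis, some of them
    possibly zero, but they still resolve the identity, and that is all that a
    functional calculus requires. *)
Lemma symmetric_spectral_frame (R : realType) (n : nat) (A : 'M[R]_n) :
  A^T = A ->
  exists (mu : 'I_n * bool -> R) (v : 'I_n * bool -> 'rV[R]_n),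
    (forall j, v j *m A = mu j *: v j) /\
    (forall x y, \sum_j v j 0 x * v j 0 y = (x == y)%:R).
Proof.
move=> Asym; pose B : 'M[R[i]]_n := map_mx (real_complex R) A.
have Bherm : B \is hermsymmx.
  apply: realsym_hermsym.
    apply/is_hermitianmxP; rewrite /= expr0 scale1r map_mx_id //.
    by rewrite map_trmx Asym.
  by apply/mxOverP => x y; rewrite mxE; apply/complex_realP; exists (A x y).
pose P := spectralmx B; pose sp := spectral_diag B.
have Punit : P \in unitmx := spectral_unit B.
have PB : P *m B = diag_mx sp *m P.
  have /orthomx_spectralP {1}-> := hermitian_normalmx Bherm.
  by rewrite !mulmxA mulmxV // mul1mx.
have PP : (map_mx Num.conj P)^T *m P = 1%:M.
  have /unitarymxP/mulmx1C := spectral_unitarymx B.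
  by rewrite map_trmx.
have spR i : sp 0 i = (complex.Re (sp 0 i))%:C%C.
  have /mxOverP/(_ 0 i) := hermitian_spectral_diag_real Bherm.
  by move=> /RRe_real ->.
pose part (b : bool) (z : R[i]) : R := if b then complex.Re z else complex.Im z.
have partD b z w : part b (z + w) = part b z + part b w.
  by rewrite /part; case: b z w => -[? ?] [].
have part0 b : part b 0 = 0 by [case: b].
have part_sum b (F : 'I_n -> R[i]) : part b (\sum_i F i) = \sum_i part b (F i).
  exact: (big_morph _ (partD b) (part0 b)).
have partM b a z : part b (a%:C%C * z) = a * part b z.
  by rewrite /part; case: b z => -[x y] /=; ring.
exists (fun j => complex.Re (sp 0 j.1)).
exists (fun j => \row_(x < n) part j.2 (P j.1 x)); split.
  move=> [i b]; apply/rowP => x; rewrite !mxE /=.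
  have := congr1 (part b) (congr1 (fun Z : matrix _ n n => Z i x) PB).
  rewrite mul_diag_mx !mxE /= [in RHS]spR partM part_sum => <-.
  by apply: eq_bigr => y _; rewrite !mxE mulrC -partM mulrC.
move=> x y; have := congr1 (fun Z : matrix _ n n => part true (Z x y)) PP.
rewrite !mxE part_sum => E; transitivity (part true ((x == y)%:R : R[i])).
  pose r i b := \row_(z < n) part b (P i z).
  rewrite -E -(pair_bigA _ (fun i b => r i b 0 x * r i b 0 y)) /=.
  apply: eq_bigr => i _; rewrite big_bool !mxE /part.
  by case: (P i x) (P i y) => [a b] [a' b'] /=; ring.
by rewrite /part; case: eqP.
Qed.

(** * Adjacency eigenfunctions of a regular graph *)

Section RegularGraphSpectrum.

Variables (R : realType) (V : finType) (G : sgraph V) (d : nat).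
Hypothesis Greg : regular_graph G d.

Lemma sum_nbhd_const (c : R) (x : V) : \sum_(y | G x y) c = d%:R * c.
Proof.
rewrite sumr_const -(Greg x) mulr_natl; congr (_ *+ _).
by apply: eq_card => y; rewrite !inE.
Qed.

Lemma sum_adj_snd (f : V -> R) :
  \sum_x \sum_(y | G x y) f y = d%:R * \sum_x f x.
Proof.
rewrite (exchange_big_dep xpredT) //= mulr_sumr; apply: eq_bigr => y _.
by rewrite -(sum_nbhd_const _ y); apply: eq_bigl => x; rewrite adj_sym.
Qed.

Definition adj_eigenfunction (mu : R) (f : V -> R) :=
  forall x, \sum_(y | G x y) f y = mu * f x.

Lemma adj_matrix_row_eigen (a : R) (g : 'rV[R]_#|V|) :
  g *m adj_matrix R G = a *: g ->
  adj_eigenfunction a (fun x => g 0 (enum_rank x)).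
Proof.
move=> Ag x; have := congr1 (fun Z : matrix _ 1 _ => Z 0 (enum_rank x)) Ag.
rewrite !mxE => <-; rewrite [RHS](reindex enum_rank) /=; last first.
  by apply: onW_bij; exact: enum_rank_bij.
rewrite big_mkcond; apply: eq_bigr => y _; rewrite !mxE !enum_rankK adj_sym.
by case: ifP; rewrite ?mulr1 ?mulr0.
Qed.

(** The left-hand side is the quadratic form of the Laplacian for s = 1 and of
    the signless Laplacian for s = -1. Treating both signs at once is what
    makes bipartite graphs no special case. *)
Lemma edge_energy (mu s : R) (f : V -> R) :
  s ^+ 2 = 1 -> adj_eigenfunction mu f ->
  \sum_x \sum_(y | G x y) (f y - s * f x) ^+ 2 =
  2 * (d%:R - s * mu) * \sum_x f x ^+ 2.
Proof.
move=> s2 Af.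
transitivity (\sum_x (\sum_(y | G x y) f y ^+ 2
    + (d%:R - 2 * s * mu) * f x ^+ 2)).
  apply: eq_bigr => x _.
  transitivity (\sum_(y | G x y) (f y ^+ 2 + (- 2 * s * f x) * f y + f x ^+ 2)).
    by apply: eq_bigr => y _; rewrite sqrrB exprMn s2; ring.
  by rewrite !big_split /= -mulr_sumr Af sum_nbhd_const; ring.
by rewrite big_split /= sum_adj_snd -mulr_sumr; ring.
Qed.

(** The energies for s = 1 and s = -1 are nonnegative. *)
Lemma adj_eigenvalue_bound (mu : R) (f : V -> R) (x : V) :
  adj_eigenfunction mu f -> f x != 0 -> `|mu| <= d%:R.
Proof.
move=> Af fx0.
have S0 : 0 < \sum_x f x ^+ 2.
  rewrite (bigD1 x) //= ltr_pwDl ?exprn_even_gt0 ?sumr_ge0 //.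
  by move=> y _; rewrite sqr_ge0.
have sgn (s : R) : s ^+ 2 = 1 -> s * mu <= d%:R.
  move=> s2; have := edge_energy s2 Af.
  have : 0 <= \sum_x \sum_(y | G x y) (f y - s * f x) ^+ 2.
    by apply: sumr_ge0 => y _; apply: sumr_ge0 => z _; rewrite sqr_ge0.
  by move=> + E; rewrite E pmulr_lge0 // pmulr_rge0 // subr_ge0.
rewrite ler_norml; have := sgn 1 (expr1n _ _); have := sgn (-1) (sqrr_sign _ 1).
by rewrite mul1r mulN1r lerNl => -> ->.
Qed.

(** For an eigenvalue of maximal modulus the energy vanishes, hence each of its
    terms does: such an eigenfunction is constant, or changes sign along each
    edge. *)
Lemma extremal_eigenfunction_edge (s : R) (f : V -> R) (x y : V) :
  s ^+ 2 = 1 -> adj_eigenfunction (s * d%:R) f -> G x y -> f y = s * f x.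
Proof.
move=> s2 Af Gxy; have := edge_energy s2 Af.
rewrite mulrA -expr2 s2 mul1r subrr mulr0 mul0r => /psumr_eq0P E.
have /psumr_eq0P/(_ y Gxy)/eqP : \sum_(y | G x y) (f y - s * f x) ^+ 2 = 0.
  by apply: E => // z _; apply: sumr_ge0 => ? _; rewrite sqr_ge0.
by rewrite sqrf_eq0 subr_eq0 => h; apply/eqP/h => ? _; rewrite sqr_ge0.
Qed.

Hypothesis Gconn : connected_graph G.

Lemma connected_invariant (T : Type) (f : V -> T) :
  (forall x y, G x y -> f y = f x) -> forall x y, f y = f x.
Proof.
move=> fG x y; have /connectP[p + ->] := Gconn x y.
by elim: p x => //= z p IHp x /andP[/fG <- /IHp].
Qed.

(** The supremum that defines the second eigenvalue only sees eigenvalues with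
    a nonzero eigenvector, while the frame may contain zero vectors. The scalar
    attached to a zero vector is arbitrary, so it is reset to the degree; the
    dichotomy between extremal and bounded eigenvalues then has no exception.
    *)
Lemma spectral_gap_frame (eps : R) :
  second_eigenvalue R G d <= d%:R - eps ->
  exists (J : finType) (mu : J -> R) (v : J -> V -> R),
    [/\ forall j, adj_eigenfunction (mu j) (v j),
        forall x y, \sum_j v j x * v j y = (x == y)%:R
      & forall j, (`|mu j| != d%:R) -> `|mu j| <= d%:R - eps].
Proof.
move=> gap; pose A := adj_matrix R G.
have [|mu [v [Av vI]]] := @symmetric_spectral_frame R _ A.
  by apply/matrixP => i j; rewrite !mxE adj_sym.
pose f j x := v j 0 (enum_rank x).
have Af j : adj_eigenfunction (mu j) (f j) by exact: adj_matrix_row_eigen.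
exists ('I_#|V| * bool)%type, (fun j => if v j == 0 then d%:R else mu j), f.
split.
- move=> j; case: eqP => // vj0 x.
  by rewrite /f vj0 !mxE mulr0 big1 // => y _; rewrite mxE.
- by move=> x y; rewrite vI (inj_eq enum_rank_inj).
move=> j; case: (v j =P 0) => [_|/eqP vj0 muj]; first by rewrite normr_nat eqxx.
apply: le_trans gap; apply: ub_le_sup; last first.
  by exists (mu j) => //; split => //; apply/eigenvalueP; exists (v j).
exists d%:R => _ [a [/eigenvalueP[g Ag g0] _] <-].
have /rV0Pn[i gi0] := g0.
apply: (adj_eigenvalue_bound (x := enum_val i) (adj_matrix_row_eigen Ag)).
by rewrite enum_valK.
Qed.

End RegularGraphSpectrum.

(** * The polynomials of non-backtracking walks *)

Lemma geometric_sum_le (R : realFieldType) (tau : R) (m : nat) :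
  0 <= tau -> tau < 1 -> \sum_(s < m) tau ^+ s <= (1 - tau)^-1.
Proof.
move=> tau0 tau1; have t1 : 0 < 1 - tau by rewrite subr_gt0.
rewrite -(ler_pM2l t1) mulfV ?gt_eqF // -opprB mulNr -subrX1 opprB.
by rewrite lerBlDr lerDl exprn_ge0.
Qed.

(** Each of the k first powers of tau is at least the k-th one. *)
Lemma nat_mul_expr_le (R : realFieldType) (tau : R) (k : nat) :
  0 <= tau -> tau < 1 -> k%:R * tau ^+ k <= (1 - tau)^-1.
Proof.
move=> t0 t1; apply: le_trans (geometric_sum_le k t0 t1).
have -> : k%:R * tau ^+ k = \sum_(i < k) tau ^+ k.
  by rewrite sumr_const card_ord mulr_natl.
by apply: ler_sum => i _; rewrite ler_wiXn2l ?(ltW t1) ?(ltnW (ltn_ord i)).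
Qed.

(** The polynomial p_k, normalised by q ^ k, whose value at the adjacency
    matrix of a (q + 1)-regular graph counts non-backtracking walks of length k
    (the Geronimus polynomials). The recurrence is regular only from k = 1 on,
    because the first step of a walk has q + 1 choices and the next ones have
    q; this is why the value at 0 is set apart. *)
Definition nbw_poly (R : realType) (q mu : R) (k : nat) : R :=
  if k is k'.+1 then
    (iter k' (fun p : R * R => (p.2, (mu * p.2 - p.1) / q))
       (mu / q, (mu ^+ 2 - (q + 1)) / q ^+ 2)).1
  else 1.

Section NbwPoly.

Variable R : realType.
Implicit Types (q mu a b c e eta theta tau : R).

Lemma nbw_polySS q mu k :
  nbw_poly q mu k.+3 = (mu * nbw_poly q mu k.+2 - nbw_poly q mu k.+1) / q.
Proof. by rewrite /nbw_poly !iterS. Qed.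

(** At q + 1 the polynomial counts all walks, and its parity is that of k. *)
Lemma nbw_poly_extremal q s k : q != 0 -> s ^+ 2 = 1 ->
  nbw_poly q (s * (q + 1)) k.+1 = s ^+ k.+1 * ((q + 1) / q).
Proof.
move=> q0 s2.
suff H : nbw_poly q (s * (q + 1)) k.+1 = s ^+ k.+1 * ((q + 1) / q) /\
  nbw_poly q (s * (q + 1)) k.+2 = s ^+ k.+2 * ((q + 1) / q) by case: H.
elim: k => [|k [IH1 IH2]].
  rewrite /nbw_poly /= exprMn s2 expr1; split; first by rewrite mulrA.
  by field.
split=> //; rewrite nbw_polySS IH2 IH1 !exprS !mulrA -expr2 s2.
have -> : s * (q + 1) * s = q + 1 by rewrite mulrAC -expr2 s2 mul1r.
by field.
Qed.

(** The pairs (a, b) with |a| < 1 + b and b < 1 are those for which both roots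
    of z ^ 2 - a z + b have modulus less than 1, but the coefficients of a
    solution in terms of the roots are unbounded when the roots come close to
    each other. A quadratic Lyapunov function W gives a uniform bound and
    covers real and complex roots alike: c is the coefficient for which the
    cross term of W k - W k.+1 cancels, and e is chosen above b ^ 2 by the
    margin eta that the hypothesis on a leaves. *)
Lemma damped_recurrence_decay a b eta (x : nat -> R) :
  0 <= b -> b <= 2^-1 -> 0 < eta -> eta <= 3 / 8 ->
  a ^+ 2 * (1 - b) <= (1 + b) * (1 - b ^+ 2 - 2 * eta) ->
  a ^+ 2 <= (1 + b) ^+ 2 ->
  (forall k, x k.+2 = a * x k.+1 - b * x k) ->
  forall k,
    x k ^+ 2 <= (1 - eta / 2) ^+ k * (2 / eta * (x 0%N ^+ 2 + x 1%N ^+ 2)).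
Proof.
move=> b0 b1 eta0 eta1 ab1 ab2 xE.
pose c := a * b / (1 + b); pose e := b ^+ 2 + eta.
have b1p : 1 + b != 0 by lra.
have c2 : c ^+ 2 <= b ^+ 2.
  rewrite /c mulrAC exprMn -[leRHS]mul1r ler_wpM2r ?sqr_ge0 // exprMn exprVn.
  by rewrite ler_pdivrMr ?mul1r // exprn_gt0 //; lra.
have b2 : b ^+ 2 <= 4^-1 by nra.
pose W k := x k.+1 ^+ 2 - 2 * c * x k * x k.+1 + e * x k ^+ 2.
have W_lb k : eta * x k ^+ 2 <= W k.
  have := sqr_ge0 (x k.+1 - c * x k); rewrite /W /e.
  have := ler_wpM2r (sqr_ge0 (x k)) c2; nra.
have W_ub k : W k <= 2 * (x k.+1 ^+ 2 + x k ^+ 2).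
  have := sqr_ge0 (x k.+1 + c * x k); rewrite /W /e.
  have h : c ^+ 2 <= 2 - (b ^+ 2 + eta) by lra.
  have := ler_wpM2r (sqr_ge0 (x k)) h; nra.
have W_step k : W k.+1 <= (1 - eta / 2) * W k.
  suff : W k.+1 + eta * (x k.+1 ^+ 2 + x k ^+ 2) <= W k.
    have := ler_wpM2l (ltW eta0) (W_ub k); lra.
  have -> : W k.+1 = W k - (1 - e - a ^+ 2 * (1 - b) / (1 + b)) * x k.+1 ^+ 2
              - eta * x k ^+ 2.
    by rewrite /W xE /e /c; field.
  have : eta <= 1 - e - a ^+ 2 * (1 - b) / (1 + b).
    rewrite lerBrDl -lerBrDr ler_pdivrMr; last by lra.
    by apply: le_trans ab1 _; rewrite /e; lra.
  by move=> /(ler_wpM2r (sqr_ge0 (x k.+1))); lra.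
have W_le k : W k <= (1 - eta / 2) ^+ k * W 0%N.
  elim: k => [|k IH]; first by rewrite mul1r.
  apply: le_trans (W_step k) _; rewrite exprS -mulrA ler_wpM2l //; lra.
move=> k; rewrite -(ler_pM2l eta0); apply: le_trans (W_lb k) _.
apply: le_trans (W_le k) _.
rewrite mulrCA ler_wpM2l ?exprn_ge0 //; first by lra.
rewrite mulrA (_ : eta * (2 / eta) = 2); last by field; rewrite gt_eqF.
by apply: le_trans (W_ub 0%N) _; lra.
Qed.

(** Divided by q ^ k, the recurrence has a = mu / q and b = 1 / q, and the
    hypothesis on mu says that a is away from 1 + b in modulus. *)
Lemma nbw_poly_decay q theta mu k :
  2 <= q -> 0 < theta -> theta <= 1 ->
  mu ^+ 2 <= (q + 1) ^+ 2 * (1 - theta) ->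
  `|nbw_poly q mu k| <= 48 / theta * (1 - 3 * theta / 64) ^+ (2 * k).
Proof.
move=> q2 th0 th1 hmu.
have q0 : 0 < q by lra.
(* Since b <= 1 / 2, one has 1 - b ^ 2 >= 3 / 4, so the margin
   theta * (1 - b ^ 2) is at least 2 * eta. *)
pose b := q^-1; pose a := mu / q; pose eta := 3 * theta / 8.
have bq : b * q = 1 by rewrite mulVf ?gt_eqF.
have b0 : 0 < b by rewrite invr_gt0.
have b1 : b <= 2^-1 by rewrite lef_pV2 ?posrE.
have a2 : a ^+ 2 <= (1 + b) ^+ 2 * (1 - theta).
  rewrite /a exprMn exprVn ler_pdivrMr ?exprn_gt0 //.
  suff -> : (1 + b) ^+ 2 * (1 - theta) * q ^+ 2 =
    (q + 1) ^+ 2 * (1 - theta) by [].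
  by rewrite /b; field; rewrite gt_eqF.
have b2 : b ^+ 2 <= 4^-1 by nra.
pose tau := 1 - 3 * theta / 64.
have tau0 : 7 / 8 <= tau by rewrite /tau; lra.
pose x k := nbw_poly q mu k.+1.
have D := @damped_recurrence_decay a b eta x (ltW b0) b1.
have {}D : forall k,
    x k ^+ 2 <= (1 - eta / 2) ^+ k * (2 / eta * (x 0%N ^+ 2 + x 1%N ^+ 2)).
  apply: D; rewrite /eta; [lra|lra| | |].
  - have b1' : 0 <= 1 - b by lra.
    apply: le_trans (ler_wpM2r b1' a2) _.
    have -> : (1 + b) ^+ 2 * (1 - theta) * (1 - b) =
      (1 + b) * ((1 - b ^+ 2) * (1 - theta)) by ring.
    rewrite ler_wpM2l //; first by lra.
    have : 0 <= theta * (4^-1 - b ^+ 2) by rewrite mulr_ge0 // ?subr_ge0 // ltW.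
    by lra.
  - apply: le_trans a2 _; rewrite ler_piMr ?sqr_ge0 //; lra.
  - by move=> j; rewrite /x nbw_polySS /a /b; field; rewrite gt_eqF.
have x0 : x 0%N ^+ 2 <= 9 / 4.
  apply: le_trans (_ : a ^+ 2 <= _); first by rewrite /x /= lexx.
  have h : 1 - theta <= 1 by lra.
  have := ler_wpM2l (sqr_ge0 (1 + b)) h; nra.
have x1 : x 1%N ^+ 2 <= 9 / 4.
  have xE : x 1%N = a ^+ 2 - b - b ^+ 2.
    by rewrite /x /= /a /b; field; rewrite gt_eqF.
  have h : 1 - theta <= 1 by lra.
  have := ler_wpM2l (sqr_ge0 (1 + b)) h; rewrite mulr1 => h'.
  have := sqr_ge0 a; rewrite xE => a20.
  have hu : a ^+ 2 - b - b ^+ 2 <= 3 / 2 by nra.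
  have hl : - (3 / 2) <= a ^+ 2 - b - b ^+ 2 by nra.
  have -> : 9 / 4 = (3 / 2) ^+ 2 :> R by field.
  by rewrite -subr_ge0 subr_sqr mulr_ge0 //; lra.
have eta0 : 0 < eta by rewrite /eta; lra.
have eta1 : eta <= 3 / 8 by rewrite /eta; lra.
have tauE : tau = 1 - eta / 8 by rewrite /tau /eta; field.
(* Bernoulli: tau avoids a fourth root of the contraction rate 1 - eta / 2 of the
   squares; the exponent of tau in the conclusion is 2 k so that a power tau ^ k
   remains to spare for each of two simultaneous bounds. *)
have t4 : 1 - eta / 2 <= tau ^+ 4.
  have h : 1 - eta / 4 <= tau ^+ 2 by rewrite tauE; nra.
  have h0 : 0 <= 1 - eta / 4 by lra.
  have := ler_pM h0 h0 h h; rewrite -exprD; nra.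
have t4' : 2^-1 <= tau ^+ 4 by apply: le_trans t4; lra.
have -> : 48 / theta = 18 / eta by rewrite /eta; field; rewrite gt_eqF.
have C18 : 18 <= 18 / eta by rewrite ler_peMr // invr_ge1 ?unitfE ?gt_eqF //; lra.
have e0 : 0 <= eta^-1 by rewrite invr_ge0 ltW.
have C0 : 0 <= 18 / eta by lra.
have T0 j : 0 <= tau ^+ j by rewrite exprn_ge0 //; lra.
case: k => [|k]; first by rewrite muln0 expr0 mulr1 normr1; lra.
rewrite -(@ler_pXn2r _ 2) ?nnegrE ?normr_ge0 ?mulr_ge0 ?T0 //.
rewrite real_normK ?num_real // -/tau.
apply: le_trans (D k) _; rewrite [leRHS]exprMn -exprM.
have -> : (2 * k.+1 * 2 = 4 * k + 4)%N by clear; lia.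
rewrite exprD exprM [leRHS]mulrCA.
rewrite ler_pM ?exprn_ge0 //; first by lra.
  by rewrite mulr_ge0 ?addr_ge0 ?sqr_ge0 // mulr_ge0.
  by rewrite lerXn2r ?nnegrE ?T0 //; lra.
apply: (@le_trans _ _ (9 / eta)).
  by rewrite mulrAC ler_wpM2r //; lra.
rewrite expr2 -mulrA.
have : 9 <= 18 / eta * tau ^+ 4 by have := ler_pM _ _ C18 t4'; lra.
by move=> /(ler_wpM2l e0); lra.
Qed.

End NbwPoly.

(** * Mass of the extremal eigenvalues *)

Section ExtremalMass.

Variables (R : realType) (V : finType) (G : sgraph V) (d : nat).
Hypothesis Greg : regular_graph G d.
Hypothesis Gconn : connected_graph G.
Variables (J : finType) (mu : J -> R) (v : J -> V -> R).
Hypothesis v_eig : forall j, adj_eigenfunction G (mu j) (v j).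
Hypothesis v_frame : forall x y, \sum_j v j x * v j y = (x == y)%:R.

Lemma frame_parseval (g : V -> R) :
  \sum_j (\sum_x v j x * g x) ^+ 2 = \sum_x g x ^+ 2.
Proof.
transitivity (\sum_j \sum_x \sum_y (v j x * g x) * (v j y * g y)).
  by apply: eq_bigr => j _; rewrite expr2 big_distrlr.
rewrite exchange_big; apply: eq_bigr => x _ /=.
rewrite exchange_big (bigD1 x) //= [X in _ + X]big1 => [|y yx]; last first.
  transitivity (g x * g y * \sum_j v j x * v j y).
    by rewrite mulr_sumr; apply: eq_bigr => j _; ring.
  by rewrite v_frame eq_sym (negPf yx) mulr0.
rewrite addr0; transitivity (g x ^+ 2 * \sum_j v j x * v j x).
  by rewrite mulr_sumr; apply: eq_bigr => j _; ring.
by rewrite v_frame eqxx mulr1.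
Qed.

(** Along an edge both factors are multiplied by the same sign s. *)
Lemma extremal_product_const (s : R) j k x y :
  s ^+ 2 = 1 -> mu j = s * d%:R -> mu k = s * d%:R ->
  v j y * v k y = v j x * v k x.
Proof.
move=> s2 muj muk.
apply: (@connected_invariant _ _ Gconn _ (fun z => v j z * v k z)) => a b Gab /=.
have ej := v_eig j; rewrite muj in ej; have ek := v_eig k; rewrite muk in ek.
rewrite (extremal_eigenfunction_edge Greg s2 ej Gab).
by rewrite (extremal_eigenfunction_edge Greg s2 ek Gab) mulrACA -expr2 s2 mul1r.
Qed.

Let n : R := #|V|%:R.

(** Extremal eigenvalues of a connected graph are simple, in the form usable
    with a frame: if some v k in the eigenspace is nonzero, its inner product
    with any other v j there is n times a constant product, and Parseval
    applied to v k bounds the sum of the squares of these inner products. *)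
Lemma eigenspace_mass_ub (s : R) x : s ^+ 2 = 1 ->
  \sum_(j | mu j == s * d%:R) v j x ^+ 2 <= n^-1.
Proof.
move=> s2; have n0 : 0 < n by rewrite ltr0n; apply/card_gt0P; exists x.
have [k /andP[/eqP muk vk]|none] :=
    pickP [pred k | (mu k == s * d%:R) && (v k x != 0)]; last first.
  rewrite big1 ?invr_ge0 ?ltW // => j muj.
  by have := none j; rewrite /= muj /= => /negbFE/eqP ->; rewrite expr0n.
have c0 : 0 < n * v k x ^+ 2 by rewrite mulr_gt0 // exprn_even_gt0.
have sum_prod j : mu j = s * d%:R -> \sum_y v j y * v k y = n * (v j x * v k x).
  move=> muj; rewrite (eq_bigr (fun=> v j x * v k x)) ?sumr_const ?mulr_natl //.
  by move=> y _; exact: (extremal_product_const _ _ s2 muj muk).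
have : \sum_(j | mu j == s * d%:R) (n * (v j x * v k x)) ^+ 2 <= n * v k x ^+ 2.
  rewrite [X in _ <= n * X]expr2 -(sum_prod _ muk).
  under [leRHS]eq_bigr do rewrite -expr2.
  rewrite -(frame_parseval (v k)).
  rewrite [leRHS](bigID (fun j => mu j == s * d%:R)) /= -[leLHS]addr0.
  rewrite lerD ?sumr_ge0 // => [|j _]; last by rewrite sqr_ge0.
  by apply: ler_sum => j /eqP muj; rewrite sum_prod.
rewrite (eq_bigr (fun j => v j x ^+ 2 * n * (n * v k x ^+ 2))) => [|j _]; last ring.
by rewrite -2!mulr_suml -[leRHS]mul1r ler_pM2r // -ler_pdivlMr // mul1r.
Qed.

Definition extremal_mass x := \sum_(j | `|mu j| == d%:R) v j x ^+ 2.

Lemma extremalE j : (`|mu j| == d%:R) = (mu j == 1 * d%:R) || (mu j == -1 * d%:R).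
Proof. by rewrite eqr_norml ler0n andbT mul1r mulN1r. Qed.

Lemma extremal_mass_ub x : extremal_mass x <= 2 / n.
Proof.
have n0 : 0 <= n^-1 by rewrite invr_ge0.
rewrite /extremal_mass (bigID (fun j => mu j == 1 * d%:R)) /= mulr_natl mulr2n.
apply: lerD.
  rewrite (eq_bigl (fun j => mu j == 1 * d%:R)) ?eigenspace_mass_ub ?expr1n //.
  by move=> j; rewrite extremalE; case: eqP; rewrite ?andbF.
apply: le_trans (eigenspace_mass_ub x (sqrr_sign _ 1)).
rewrite big_mkcond [leRHS]big_mkcond; apply: ler_sum => j _.
rewrite extremalE expr1; do 2 case: eqP => _ //=; exact: sqr_ge0.
Qed.

(** The constant function is orthogonal to all eigenfunctions with eigenvalue
    different from d, so that by Parseval the eigenvalue d alone has mass 1 / n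
    at each vertex. *)
Lemma extremal_mass_lb x : n^-1 <= extremal_mass x.
Proof.
have n0 : 0 < n by rewrite ltr0n; apply/card_gt0P; exists x.
have orth j : mu j != d%:R -> \sum_y v j y = 0.
  move=> muj; have := sum_adj_snd Greg (v j).
  rewrite (eq_bigr (fun y => mu j * v j y)) => [|y _]; last exact: v_eig.
  rewrite -mulr_sumr => /eqP; rewrite -subr_eq0 -mulrBl mulf_eq0 subr_eq0.
  by rewrite (negPf muj) => /eqP.
have := frame_parseval (fun=> 1).
under eq_bigr => j _ do under eq_bigr => y _ do rewrite mulr1.
rewrite expr1n sumr_const -/n (bigID (fun j => mu j == d%:R)) /=.
rewrite [X in _ + X]big1 => [|j muj]; last by rewrite orth ?expr0n.
rewrite addr0 => E; rewrite -(ler_pM2l n0) mulfV ?gt_eqF // -(ler_pM2l n0) mulr1.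
rewrite -[leLHS]E big_mkcond !mulr_sumr [leRHS]big_mkcond; apply: ler_sum => j _.
rewrite extremalE mul1r mulN1r; case: eqP => [muj|_] /=; last first.
  by case: ifP => // _; do 2! [apply: mulr_ge0; first exact: ltW]; exact: sqr_ge0.
rewrite (eq_bigr (fun=> v j x)) ?sumr_const -?[X in X ^+ 2]mulr_natl.
  by rewrite exprMn mulrA -expr2.
move=> y _; apply: (@connected_invariant _ _ Gconn _ (v j)) => a b Gab.
have ej := v_eig j; rewrite muj -[d%:R]mul1r in ej.
by rewrite (extremal_eigenfunction_edge Greg (expr1n _ _) ej Gab) mul1r.
Qed.

End ExtremalMass.

(** * Transfer operator and transition kernel *)

Section NbwOperator.

Variables (R : realType) (V : finType) (G : sgraph V) (d : nat).
Hypothesis Greg : regular_graph G d.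
Hypothesis d3 : (3 <= d)%N.

Let q : R := d%:R - 1.

Let q2 : 2 <= q.
Proof. by rewrite /q lerBrDr -(natrD _ 2 1) ler_nat. Qed.

Let q0 : 0 < q.
Proof. by apply: lt_le_trans q2. Qed.

(** The walk is a Markov chain on directed edges (previous vertex, current
    vertex); this is its transition operator acting on functions. *)
Definition nbw_op (phi : V * V -> R) (e : V * V) : R :=
  (d%:R - 1)^-1 * \sum_(z | G e.2 z && (z != e.1)) phi (e.2, z).

Lemma nbw_opE phi e :
  nbw_op phi e = q^-1 * \sum_(z | G e.2 z && (z != e.1)) phi (e.2, z).
Proof. by []. Qed.

Lemma sum_forward_const (c : R) (e : V * V) : G e.1 e.2 ->
  \sum_(z | G e.2 z && (z != e.1)) c = q * c.
Proof.
move=> Ge; have := sum_nbhd_const Greg c e.2.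
have Ge' : G e.2 e.1 by rewrite adj_sym.
rewrite (bigD1 e.1) //= => /(congr1 (+%R (- c))); rewrite addKr => ->.
by rewrite /q mulrBl mul1r addrC.
Qed.

Lemma iter_nbw_op_le k (phi psi : V * V -> R) :
  (forall e, G e.1 e.2 -> phi e <= psi e) ->
  forall e, G e.1 e.2 -> iter k nbw_op phi e <= iter k nbw_op psi e.
Proof.
move=> le_pp; elim: k => //= k IH e Ge.
rewrite !nbw_opE ler_wpM2l ?invr_ge0 ?(ltW q0) //.
by apply: ler_sum => z /andP[Gz _]; apply: IH.
Qed.

Lemma eq_iter_nbw_op k (phi psi : V * V -> R) :
  (forall e, G e.1 e.2 -> phi e = psi e) ->
  forall e, G e.1 e.2 -> iter k nbw_op phi e = iter k nbw_op psi e.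
Proof.
move=> eq_pp e Ge; apply/le_anti/andP; split;
  by apply: iter_nbw_op_le => // e' Ge'; rewrite eq_pp.
Qed.

Lemma iter_nbw_op_const k (c : R) (e : V * V) : G e.1 e.2 ->
  iter k nbw_op (fun=> c) e = c.
Proof.
elim: k e => //= k IH e Ge; rewrite !nbw_opE.
rewrite (eq_bigr (fun=> c)) => [|z /andP[Gz _]]; last exact: IH.
by rewrite sum_forward_const // mulKf // gt_eqF.
Qed.

Lemma iter_nbw_op_le_const k (phi : V * V -> R) (c : R) (e : V * V) :
  (forall e', G e'.1 e'.2 -> phi e' <= c) -> G e.1 e.2 ->
  iter k nbw_op phi e <= c.
Proof.
by move=> le_c Ge; rewrite -(iter_nbw_op_const k c Ge); apply: iter_nbw_op_le.
Qed.

Lemma iter_nbw_op_sum (I : finType) (P : pred I) k (phi : I -> V * V -> R) e :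
  iter k nbw_op (fun e' => \sum_(i | P i) phi i e') e =
  \sum_(i | P i) iter k nbw_op (phi i) e.
Proof.
elim: k e => //= k IH e; rewrite !nbw_opE (eq_bigr _ (fun z _ => IH _)).
by rewrite exchange_big /= mulr_sumr.
Qed.

Lemma iter_nbw_opZ k (c : R) (phi : V * V -> R) e :
  iter k nbw_op (fun e' => c * phi e') e = c * iter k nbw_op phi e.
Proof.
elim: k e => //= k IH e; rewrite !nbw_opE (eq_bigr _ (fun z _ => IH _)).
by rewrite -mulr_sumr mulrCA.
Qed.

Definition nbw_hit k (e : V * V) (y : V) : R :=
  iter k nbw_op (fun e' => (e'.2 == y)%:R) e.

(** Number of non-backtracking walks of length k from x to y, divided by q ^ k.
    The first step has q + 1 choices, so this is not a probability: the total
    mass is (q + 1) / q for k > 0. With this normalisation the kernel is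
    exactly a polynomial in the adjacency matrix, in particular symmetric. *)
Definition nbw_kernel k (x y : V) : R :=
  if k is k'.+1 then (d%:R - 1)^-1 * \sum_(z | G x z) nbw_hit k' (x, z) y
  else (x == y)%:R.

Lemma nbw_hit_ge0 k e y : G e.1 e.2 -> 0 <= nbw_hit k e y.
Proof.
move=> Ge; rewrite -(iter_nbw_op_const k 0 Ge).
by apply: iter_nbw_op_le => // e' _; rewrite ler0n.
Qed.

Lemma iter_nbw_op_hit k (g : V -> R) e :
  iter k nbw_op (fun e' => g e'.2) e = \sum_y nbw_hit k e y * g y.
Proof.
transitivity (iter k nbw_op (fun e' => \sum_y g y * (e'.2 == y)%:R) e).
  congr (iter _ _ _ _); apply/funext => e'.
  rewrite (bigD1 e'.2) //= eqxx mulr1 big1 ?addr0 // => y.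
  by rewrite eq_sym => /negPf ->; rewrite mulr0.
rewrite iter_nbw_op_sum; apply: eq_bigr => y _.
by rewrite iter_nbw_opZ mulrC.
Qed.

Lemma sum_nbw_hit k e : G e.1 e.2 -> \sum_y nbw_hit k e y = 1.
Proof.
move=> Ge; rewrite -[RHS](iter_nbw_op_const k 1 Ge) (iter_nbw_op_hit k (fun=> 1)).
by apply: eq_bigr => y _; rewrite mulr1.
Qed.

Lemma nbw_kernel_ge0 k x y : 0 <= nbw_kernel k x y.
Proof.
case: k => [|k] /=; first by rewrite ler0n.
rewrite mulr_ge0 ?invr_ge0 ?(ltW q0) // sumr_ge0 // => z Gz.
exact: nbw_hit_ge0.
Qed.

Lemma sum_nbw_kernel k x : \sum_y nbw_kernel k x y <= 2.
Proof.
case: k => [|k] /=.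
  rewrite (bigD1 x) //= eqxx big1 ?addr0 ?ler1n // => y.
  by rewrite eq_sym => /negPf ->.
rewrite -mulr_sumr exchange_big /= (eq_bigr (fun=> 1)) => [|z Gz]; last first.
  exact: sum_nbw_hit.
rewrite (sum_nbhd_const Greg) mulr1 ler_pdivrMl //; move: q2; rewrite /q; lra.
Qed.

(** The continuations of the edge (w, x) are the walks from x except those that
    start by going back to w, which are continuations of the edge (x, w). *)
Lemma nbw_hitS k w x y : G w x ->
  nbw_hit k.+1 (w, x) y = nbw_kernel k.+1 x y - q^-1 * nbw_hit k (x, w) y.
Proof.
move=> Gwx; have Gxw : G x w by rewrite adj_sym.
rewrite [in RHS]/nbw_kernel (bigD1 w) //= mulrDr addrC.
by rewrite -/q addKr.
Qed.

Lemma nbw_hit_le k e y : G e.1 e.2 -> nbw_hit k e y <= nbw_kernel k e.2 y.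
Proof.
case: e k => w x [|k] Gwx; first exact: lexx.
rewrite nbw_hitS // lerBlDr lerDl.
by rewrite mulr_ge0 ?invr_ge0 ?(ltW q0) ?nbw_hit_ge0 //= adj_sym.
Qed.

Lemma nbw_kernel2 x y :
  nbw_kernel 2 x y =
  q^-1 * (\sum_(z | G x z) nbw_kernel 1 z y) - d%:R / q ^+ 2 * nbw_kernel 0 x y.
Proof.
rewrite {1}/nbw_kernel (eq_bigr _ (fun z Gz => nbw_hitS 0 y Gz)).
rewrite sumrB -/q mulrBr; congr (_ - _).
rewrite (_ : \sum_(i | G x i) _ = d%:R * (q^-1 * (x == y)%:R)).
  by rewrite /=; field; rewrite gt_eqF.
exact: (sum_nbhd_const Greg (q^-1 * (x == y)%:R) x).
Qed.

(** In the sum over neighbours z of x of the walks that come back from z to x,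
    each walk from x starting with z' is counted for the q neighbours z other
    than z'. *)
Lemma nbw_kernelS3 k x y :
  nbw_kernel k.+3 x y =
  q^-1 * (\sum_(z | G x z) nbw_kernel k.+2 z y) - q^-1 * nbw_kernel k.+1 x y.
Proof.
rewrite {1}/nbw_kernel (eq_bigr _ (fun z Gz => nbw_hitS k.+1 y Gz)).
rewrite sumrB -/q mulrBr; congr (_ - _ * _).
rewrite -mulr_sumr /= /nbw_op /= -mulr_sumr (exchange_big_dep (G x)) /=; last first.
  by move=> z z' _ /andP[].
congr (_ * _); rewrite mulr_sumr; apply: eq_bigr => z Gz.
rewrite -[RHS](mulKf (x := q)) ?gt_eqF //; congr (_ * _).
rewrite (eq_bigl (fun z' => G x z' && (z' != z))) => [|z']; last first.
  by rewrite Gz eq_sym.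
have Gzx : G (z, x).1 (z, x).2 by rewrite /= adj_sym.
by rewrite (sum_forward_const _ Gzx).
Qed.

Section SpectralExpansion.

Variables (J : finType) (mu : J -> R) (v : J -> V -> R).
Hypothesis v_eig : forall j, adj_eigenfunction G (mu j) (v j).
Hypothesis v_frame : forall x y, \sum_j v j x * v j y = (x == y)%:R.

Lemma nbw_kernel_expansion k x y :
  nbw_kernel k x y = \sum_j nbw_poly q (mu j) k * (v j x * v j y).
Proof.
have adjE (f : J -> R) x' : \sum_(z | G x' z) \sum_j f j * (v j z * v j y) =
    \sum_j mu j * f j * (v j x' * v j y).
  rewrite exchange_big /=; apply: eq_bigr => j _.
  rewrite -mulr_sumr -mulr_suml v_eig; ring.
have E0 x' : nbw_kernel 0 x' y = \sum_j nbw_poly q (mu j) 0 * (v j x' * v j y).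
  by rewrite /= -v_frame; apply: eq_bigr => j _; rewrite mul1r.
have E1 x' : nbw_kernel 1 x' y = \sum_j nbw_poly q (mu j) 1 * (v j x' * v j y).
  rewrite /= /nbw_hit /= (eq_bigr _ (fun z _ => E0 z)) adjE mulr_sumr.
  by apply: eq_bigr => j _ /=; rewrite -/q; ring.
have E2 x' : nbw_kernel 2 x' y = \sum_j nbw_poly q (mu j) 2 * (v j x' * v j y).
  rewrite nbw_kernel2 (eq_bigr _ (fun z _ => E1 z)) adjE E0 !mulr_sumr -sumrB.
  apply: eq_bigr => j _; rewrite /nbw_poly /= (_ : q + 1 = d%:R) ?subrK //.
  by field; rewrite gt_eqF.
suff H m x' : nbw_kernel m.+1 x' y =
      \sum_j nbw_poly q (mu j) m.+1 * (v j x' * v j y) /\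
    nbw_kernel m.+2 x' y = \sum_j nbw_poly q (mu j) m.+2 * (v j x' * v j y).
  by case: k => [|k]; [exact: E0 | case: (H k x)].
elim: m x' => [|m IH] x'; first by rewrite E1 E2.
split; first by case: (IH x').
rewrite nbw_kernelS3 (eq_bigr _ (fun z _ => proj2 (IH z))) adjE (proj1 (IH x')).
rewrite !mulr_sumr -sumrB; apply: eq_bigr => j _.
by rewrite nbw_polySS; field; rewrite gt_eqF.
Qed.

End SpectralExpansion.

End NbwOperator.

(** * Bounds on the transition kernel *)

Section KernelBounds.

Variables (R : realType) (V : finType) (G : sgraph V) (d : nat).
Hypothesis Greg : regular_graph G d.
Hypothesis d3 : (3 <= d)%N.
Hypothesis Gconn : connected_graph G.
Variables (J : finType) (mu : J -> R) (v : J -> V -> R).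
Hypothesis v_eig : forall j, adj_eigenfunction G (mu j) (v j).
Hypothesis v_frame : forall x y, \sum_j v j x * v j y = (x == y)%:R.
Variable theta : R.
Hypotheses (th0 : 0 < theta) (th1 : theta <= 1).
Hypothesis gap :
  forall j, `|mu j| != d%:R -> mu j ^+ 2 <= d%:R ^+ 2 * (1 - theta).

Let n : R := #|V|%:R.
Let q : R := d%:R - 1.
Let C : R := 48 / theta.
Let tau : R := 1 - 3 * theta / 64.

Let q2 : 2 <= q.
Proof. by rewrite /q lerBrDr -(natrD _ 2 1) ler_nat. Qed.

Let qd : q + 1 = d%:R.
Proof. by rewrite /q subrK. Qed.

Let nbw_poly_gap j k : `|mu j| != d%:R ->
  `|nbw_poly q (mu j) k| <= C * tau ^+ (2 * k).
Proof. by move=> /gap; rewrite -qd; apply: nbw_poly_decay. Qed.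

Let extremalP j : `|mu j| = d%:R ->
  exists2 s : R, s ^+ 2 = 1 & mu j = s * (q + 1).
Proof.
move=> /eqP; rewrite extremalE qd => /orP[] /eqP ->.
  by exists 1; rewrite ?expr1n.
by exists (-1); rewrite ?(sqrr_sign _ 1).
Qed.

Let CT k : 0 <= C * tau ^+ k.
Proof. have [h0 h1] : 0 < theta /\ theta <= 1 by [].
have t0 : 0 <= tau by rewrite /tau; lra.
by rewrite mulr_ge0 ?divr_ge0 ?exprn_ge0 ?(ltW th0). Qed.

Let mul_le_avg (a b : R) : `|a * b| <= 2^-1 * (a ^+ 2 + b ^+ 2).
Proof.
rewrite ler_norml; have := sqr_ge0 (a + b); have := sqr_ge0 (a - b).
by rewrite sqrrB sqrrD => h1 h2; apply/andP; split; lra.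
Qed.

Let frame_sq z : \sum_j v j z ^+ 2 = 1.
Proof. by under eq_bigr do rewrite expr2; rewrite v_frame eqxx. Qed.

(** Extremal eigenvalues have mass at most 2 / n and polynomial values at most
    2; the other ones decay, and the frame has total mass 1 at each vertex. *)
Lemma nbw_kernel_ub k x y : nbw_kernel R G d k x y <= 4 / n + C * tau ^+ (2 * k).
Proof.
have [h0 h1 hq] : [/\ 0 < theta, theta <= 1 & 2 <= q] by [].
rewrite (nbw_kernel_expansion Greg d3 v_eig v_frame) -/q.
pose w j := 2^-1 * (v j x ^+ 2 + v j y ^+ 2).
have w0 j : 0 <= w j by rewrite mulr_ge0 ?invr_ge0 // addr_ge0 ?sqr_ge0.
apply: (@le_trans _ _ (\sum_j (2 * (if `|mu j| == d%:R then w j else 0)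
                             + C * tau ^+ (2 * k) * w j))).
  apply: ler_sum => j _; apply: le_trans (ler_norm _) _; rewrite normrM.
  apply: le_trans (ler_wpM2l (normr_ge0 _) (mul_le_avg _ _)) _; rewrite -/(w j).
  case: eqP => [/extremalP[s s2 muj]|/eqP muj].
    apply: le_trans (_ : 2 * w j <= _); last by rewrite lerDl mulr_ge0.
    rewrite ler_wpM2r // muj.
    case: k => [|k]; first by rewrite /= normr1; lra.
    rewrite nbw_poly_extremal ?gt_eqF //; last lra.
    have -> : `|s ^+ k.+1 * ((q + 1) / q)| = (q + 1) / q.
      have /eqP s1 : `|s| == 1 by rewrite -sqrp_eq1 // real_normK ?num_real ?s2.
      rewrite normrM normrX s1 expr1n mul1r ger0_norm // divr_ge0 //; lra.
    rewrite ler_pdivrMr; lra.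
  by rewrite mulr0 add0r ler_wpM2r // nbw_poly_gap.
rewrite big_split /= -!mulr_sumr -big_mkcond /= lerD //; last first.
  rewrite big_split /= !frame_sq -[leRHS]mulr1 ler_wpM2l //; lra.
have := extremal_mass_ub Greg Gconn v_eig v_frame x.
have := extremal_mass_ub Greg Gconn v_eig v_frame y.
rewrite -mulr_sumr big_split /= -/n -!/(extremal_mass _ _ _ _); lra.
Qed.

Lemma nbw_kernel_sym k x y : nbw_kernel R G d k x y = nbw_kernel R G d k y x.
Proof.
rewrite !(nbw_kernel_expansion Greg d3 v_eig v_frame).
by apply: eq_bigr => j _; rewrite [v j x * _]mulrC.
Qed.

(** Discarding the walks that start by going back to w costs at most the kernel
    from w to x with one step less. The extremal parts of both terms have the
    same sign because the length is even and w is adjacent to x; the second is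
    smaller by a factor q, which leaves 1 - q ^ -2 >= 3 / 4 of the extremal
    mass. *)
Lemma nbw_return_lb m (e : V * V) : G e.1 e.2 ->
  3 / 4 / n - 2 * (C * tau ^+ m.*2.+2) <= nbw_hit R G d m.*2.+2 e e.2.
Proof.
have [h0 h1 hq] : [/\ 0 < theta, theta <= 1 & 2 <= q] by [].
case: e => w x Gwx; rewrite -[(w, x).2]/x nbw_hitS // -/q.
have Gxw : G x w by rewrite adj_sym.
have qV0 : 0 <= q^-1 by rewrite invr_ge0; lra.
have qV2 : q^-1 <= 2^-1 by rewrite lef_pV2 ?posrE //; lra.
have H := @nbw_hit_le R V G d Greg d3 m.*2.+1 (x, w) x Gxw.
apply: (@le_trans _ _ (nbw_kernel R G d m.*2.+2 x x -
                        q^-1 * nbw_kernel R G d m.*2.+1 w x)); last first.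
  by rewrite lerB // ler_wpM2l.
set D := C * tau ^+ m.*2.+2.
rewrite !(nbw_kernel_expansion Greg d3 v_eig v_frame) -/q mulr_sumr -sumrB.
have tau01 : 0 <= tau <= 1 by rewrite /tau; apply/andP; split; lra.
have [tau0 tau1] := andP tau01.
have D_le k : (m.*2.+2 <= k)%N -> C * tau ^+ k <= D.
  move=> le_mk; rewrite ler_wpM2l ?divr_ge0 ?(ltW th0) //.
  by rewrite ler_wiXn2l.
pose u j := v j x ^+ 2 + 2^-1 * (2^-1 * (v j w ^+ 2 + v j x ^+ 2)).
apply: (@le_trans _ _ (\sum_j
    (3 / 4 * (if `|mu j| == d%:R then v j x ^+ 2 else 0) - D * u j))).
  rewrite sumrB -!mulr_sumr -big_mkcond /= -/(extremal_mass _ _ _ _).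
  have := extremal_mass_lb Greg Gconn v_eig v_frame x; rewrite -/n => am.
  have -> : \sum_j u j = 3 / 2.
    by rewrite big_split /= -!mulr_sumr big_split /= !frame_sq; field.
  have := CT m.*2.+2; rewrite -/D; lra.
apply: ler_sum => j _.
have u0 : 0 <= u j.
  by rewrite addr_ge0 ?sqr_ge0 // !mulr_ge0 ?invr_ge0 ?addr_ge0 ?sqr_ge0.
case: eqP => [/[dup] muj' /extremalP[s s2 muj]|/eqP muj].
  have Du := mulr_ge0 (CT m.*2.+2) u0; rewrite -/D in Du.
  have ej := v_eig j; rewrite muj qd in ej.
  have -> : v j w = s * v j x by apply: (extremal_eigenfunction_edge Greg s2 ej).
  rewrite muj !nbw_poly_extremal ?gt_eqF //; try lra.
  have s2k : s ^+ m.*2 = 1 by rewrite -mul2n exprM s2 expr1n.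
  have -> : s ^+ m.*2.+2 = 1 by rewrite !exprS s2k mulr1 -expr2.
  have -> : s ^+ m.*2.+1 = s by rewrite exprS s2k mulr1.
  rewrite mul1r.
  have -> : (q + 1) / q * (v j x * v j x) -
      q^-1 * (s * ((q + 1) / q) * (s * v j x * v j x)) =
      (1 - q^-1 ^+ 2) * v j x ^+ 2.
    have q0 : q != 0 by rewrite gt_eqF //; lra.
    transitivity ((q + 1) / q * v j x ^+ 2 - s ^+ 2 * (q + 1) / q ^+ 2 * v j x ^+ 2).
      by field.
    by rewrite s2; field.
  have : 3 / 4 <= 1 - q^-1 ^+ 2 by nra.
  by move=> /(ler_wpM2r (sqr_ge0 (v j x))); lra.
rewrite mulr0 sub0r lerNl opprB.
apply: (@le_trans _ _ (q^-1 * (D * (2^-1 * (v j w ^+ 2 + v j x ^+ 2))) +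
    D * v j x ^+ 2)).
  rewrite lerD //; last first.
    apply: le_trans (_ : `|nbw_poly q (mu j) m.*2.+2 * (v j x * v j x)| <= _).
      by rewrite -normrN ler_norm.
    rewrite normrM -expr2 [X in _ * X]ger0_norm ?sqr_ge0 // ler_wpM2r ?sqr_ge0 //.
    by apply: le_trans (nbw_poly_gap _ muj) (D_le _ _); clear; lia.
  rewrite ler_wpM2l //; apply: le_trans (ler_norm _) _; rewrite normrM.
  rewrite ler_pM ?normr_ge0 // ?mul_le_avg //.
  by apply: le_trans (nbw_poly_gap _ muj) (D_le _ _); clear; lia.
have Dw : 0 <= D * (2^-1 * (v j w ^+ 2 + v j x ^+ 2)).
  by rewrite mulr_ge0 ?CT // mulr_ge0 ?invr_ge0 ?addr_ge0 ?sqr_ge0.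
have := ler_wpM2r Dw qV2; rewrite /u; lra.
Qed.

End KernelBounds.

(** * Expectation along non-backtracking paths *)

Section PathExpectation.

Variables (R : realType) (V : finType) (G : sgraph V) (d : nat).

(** The recursion is on lists of vertices rather than through powers of
    [nbw_op], because being self-avoiding depends on the whole path. *)
Fixpoint nbw_exp (k : nat) (e : V * V) (F : seq V -> R) : R :=
  if k is k'.+1 then
    (d%:R - 1)^-1 * \sum_(z | G e.2 z && (z != e.1))
      nbw_exp k' (e.2, z) (fun l => F (z :: l))
  else F [::].

Definition last_edge (e : V * V) (l : seq V) : V * V :=
  foldl (fun e z => (e.2, z)) e l.

(** Position at time t of a path that starts at x at time 0. Taking a prefix
    rather than an entry makes the splitting of times ([path_atD])
    unconditional. *)
Definition path_at (x : V) (l : seq V) (t : nat) : V := last x (take t l).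

Local Notation op := (@nbw_op R V G d).

Lemma last_edge2 e l : (last_edge e l).2 = last e.2 l.
Proof. by elim: l e => //= z l IH e; rewrite IH. Qed.

Lemma eq_nbw_exp k e F F' :
  (forall l, size l = k -> F l = F' l) -> nbw_exp k e F = nbw_exp k e F'.
Proof.
elim: k e F F' => [|k IH] e F F' FF' /=; first exact: FF'.
congr (_ * _); apply: eq_bigr => z _; apply: IH => l sz.
by apply: FF'; rewrite /= sz.
Qed.

Lemma nbw_exp_cat a b e F :
  nbw_exp (a + b) e F =
  nbw_exp a e (fun l1 => nbw_exp b (last_edge e l1) (fun l2 => F (l1 ++ l2))).
Proof.
elim: a e F => //= a IH e F; congr (_ * _).
by apply: eq_bigr => z _; rewrite IH.
Qed.

Lemma nbw_exp_last_edge k e (phi : V * V -> R) :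
  nbw_exp k e (fun l => phi (last_edge e l)) = iter k op phi e.
Proof.
elim: k e => //= k IH e; rewrite /nbw_op; congr (_ * _).
by apply: eq_bigr => z _; rewrite -IH.
Qed.

(** The Markov property at time a. *)
Lemma nbw_exp_split a b e (F : V -> seq V -> R) :
  nbw_exp (a + b) e (fun l => F (path_at e.2 l a) (drop a l)) =
  iter a op (fun e' => nbw_exp b e' (F e'.2)) e.
Proof.
rewrite -nbw_exp_last_edge nbw_exp_cat; apply: eq_nbw_exp => l1 sz.
apply: eq_nbw_exp => l2 _; rewrite last_edge2 /path_at -sz.
by rewrite take_size_cat // drop_size_cat.
Qed.

Lemma path_atD x l a t :
  path_at x l (a + t) = path_at (path_at x l a) (drop a l) t.
Proof. by rewrite /path_at takeD last_cat. Qed.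

Lemma path_at_nth x l t : (t <= size l)%N -> path_at x l t = nth x (x :: l) t.
Proof.
move=> tl; rewrite /path_at (last_nth x) size_takel //.
by case: t tl => //= t tl; rewrite nth_take.
Qed.

Lemma nbw_exp_times2 a b r e (g : V -> V -> R) :
  nbw_exp (a + (b + r)) e (fun l => g (path_at e.2 l a) (path_at e.2 l (a + b))) =
  iter a op (fun e1 => iter b op (fun e2 => nbw_exp r e2 (fun=> g e1.2 e2.2)) e1) e.
Proof.
under eq_nbw_exp => l _ do rewrite path_atD.
rewrite (nbw_exp_split _ _ _ (fun x l => g x (path_at x l b))).
congr (iter _ _ _ _); apply/funext => e1.
by rewrite (nbw_exp_split _ _ _ (fun y _ => g e1.2 y)).
Qed.

Lemma nbw_exp_times4 a b c c' r e (g : V -> V -> V -> V -> R) :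
  nbw_exp (a + (b + (c + (c' + r)))) e (fun l =>
     g (path_at e.2 l a) (path_at e.2 l (a + b)) (path_at e.2 l (a + b + c))
       (path_at e.2 l (a + b + c + c'))) =
  iter a op (fun e1 => iter b op (fun e2 => iter c op (fun e3 => iter c' op
    (fun e4 => nbw_exp r e4 (fun=> g e1.2 e2.2 e3.2 e4.2)) e3) e2) e1) e.
Proof.
under eq_nbw_exp => l _ do rewrite -!addnA !(path_atD _ _ a).
rewrite (nbw_exp_split _ _ _ (fun x l => g x (path_at x l b)
  (path_at x l (b + c)) (path_at x l (b + (c + c'))))).
congr (iter _ _ _ _); apply/funext => e1.
under eq_nbw_exp => l _ do rewrite !(path_atD _ _ b).
rewrite (nbw_exp_split _ _ _ (fun y l => g e1.2 y (path_at y l c)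
  (path_at y l (c + c')))).
congr (iter _ _ _ _); apply/funext => e2.
exact: (nbw_exp_times2 _ _ _ _ (g e1.2 e2.2)).
Qed.

Lemma nbw_exp_sum (I : finType) (P : pred I) k e (F : I -> seq V -> R) :
  nbw_exp k e (fun l => \sum_(i | P i) F i l) = \sum_(i | P i) nbw_exp k e (F i).
Proof.
elim: k e F => //= k IH e F; rewrite (eq_bigr _ (fun z _ => IH _ _)).
by rewrite exchange_big /= mulr_sumr.
Qed.

Lemma nbw_expD k e F F' :
  nbw_exp k e (fun l => F l + F' l) = nbw_exp k e F + nbw_exp k e F'.
Proof.
elim: k e F F' => //= k IH e F F'; rewrite (eq_bigr _ (fun z _ => IH _ _ _)).
by rewrite big_split mulrDr.
Qed.

Lemma nbw_expZ c k e F : nbw_exp k e (fun l => c * F l) = c * nbw_exp k e F.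
Proof.
elim: k e F => //= k IH e F; rewrite (eq_bigr _ (fun z _ => IH _ _)).
by rewrite -mulr_sumr mulrCA.
Qed.

Hypothesis Greg : regular_graph G d.
Hypothesis d3 : (3 <= d)%N.

Lemma nbw_exp_le k e F F' :
  (forall l, size l = k -> F l <= F' l) -> nbw_exp k e F <= nbw_exp k e F'.
Proof.
elim: k e F F' => [|k IH] e F F' FF' /=; first exact: FF'.
rewrite ler_wpM2l ?invr_ge0 ?subr_ge0 ?ler1n ?(leq_trans _ d3) //.
by apply: ler_sum => z _; apply: IH => l sz; apply: FF'; rewrite /= sz.
Qed.

Lemma nbw_exp_const k e c : G e.1 e.2 -> nbw_exp k e (fun=> c) = c.
Proof.
move=> Ge; rewrite -[RHS](iter_nbw_op_const Greg d3 k c Ge).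
exact: (nbw_exp_last_edge _ _ (fun=> c)).
Qed.

End PathExpectation.

(** * Self-intersections inside a block *)

Section BlockIntersection.

Variables (R : realType) (V : finType) (G : sgraph V) (d : nat).
Hypothesis Greg : regular_graph G d.
Hypothesis d3 : (3 <= d)%N.
Variables (A tau : R) (L : nat).
Let n : R := #|V|%:R.
Hypotheses (A1 : 1 <= A) (tau0 : 0 < tau) (tau1 : tau < 1).
Hypothesis kernel_ub :
  forall k x y, nbw_kernel R G d k x y <= A / n + A * tau ^+ (2 * k).
Hypothesis kernel_sym :
  forall k x y, nbw_kernel R G d k x y = nbw_kernel R G d k y x.
Hypothesis return_lb : forall m e, G e.1 e.2 ->
  3 / 4 / n - 2 * (A * tau ^+ m.*2.+2) <= nbw_hit R G d m.*2.+2 e e.2.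
Hypothesis L_mix : A * tau ^+ (2 * L) <= (16 * n)^-1.
Hypothesis L_large : n <= L%:R ^+ 2.

Local Notation op := (@nbw_op R V G d).
Local Notation hit := (nbw_hit R G d).
Local Notation ker := (nbw_kernel R G d).

Let nV0 : 0 <= n^-1.
Proof. by rewrite invr_ge0 ler0n. Qed.

Let A0 : 0 <= A.
Proof. by apply: le_trans A1. Qed.

Let tauX k : 0 <= tau ^+ k.
Proof. by rewrite exprn_ge0 // ltW. Qed.

Let tau_le i j : (i <= j)%N -> A * tau ^+ j <= A * tau ^+ i.
Proof. by move=> ij; rewrite ler_wpM2l // ler_wiXn2l // ltW. Qed.

(** Probability, up to constants, that two walks from the same vertex, of
    lengths a and c, have the same end. Either factor can be bounded uniformly
    while the other is summed, so the longer of the two lengths governs the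
    decay; since the uniform bounds decay like tau ^ (2 a) and tau ^ (2 c), the
    product tau ^ a * tau ^ c bounds the smaller one. *)
Lemma sum_hit_kernel a c e : G e.1 e.2 ->
  \sum_y hit a e y * ker c e.2 y <= 2 * (A / n + A * (tau ^+ a * tau ^+ c)).
Proof.
move=> Ge; rewrite -exprD; have [ac|/ltnW ca] := leqP a c.
  apply: (@le_trans _ _ (\sum_y hit a e y * (A / n + A * tau ^+ (a + c)))).
    apply: ler_sum => y _; rewrite ler_wpM2l ?nbw_hit_ge0 //.
    apply: le_trans (kernel_ub _ _ _) _; rewrite lerD2l.
    by apply: tau_le; rewrite mul2n -addnn leq_add2r.
  rewrite -mulr_suml (sum_nbw_hit _ Greg d3 a Ge) mul1r ler_peMl //.
    by rewrite addr_ge0 ?mulr_ge0.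
  by rewrite ler1n.
apply: (@le_trans _ _ (\sum_y (A / n + A * tau ^+ (a + c)) * ker c e.2 y)).
  apply: ler_sum => y _; rewrite ler_wpM2r ?nbw_kernel_ge0 //.
  apply: le_trans (nbw_hit_le _ Greg d3 _ _ Ge) _.
  apply: le_trans (kernel_ub _ _ _) _; rewrite lerD2l.
  by apply: tau_le; rewrite mul2n -addnn leq_add2l.
rewrite -mulr_sumr mulrC ler_wpM2r ?sum_nbw_kernel //.
by rewrite addr_ge0 ?mulr_ge0.
Qed.

Lemma hit_mixed b e y : G e.1 e.2 -> (L <= b)%N -> hit b e y <= 2 * A / n.
Proof.
move=> Ge Lb; apply: le_trans (nbw_hit_le _ Greg d3 _ _ Ge) _.
apply: le_trans (kernel_ub _ _ _) _.
rewrite -mulrA mulr_natl mulr2n lerD2l.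
apply: (@le_trans _ _ (A * tau ^+ (2 * L))); first by rewrite tau_le // leq_mul2l.
apply: le_trans L_mix _; rewrite invfM ler_wpM2r //.
by apply: le_trans A1; rewrite invf_le1 // ler1n.
Qed.

(** The walk mixes before it reaches x, which gives the factor of order 1 / n;
    from x on, forgetting which edge led there only increases the bound. *)
Lemma iter_two_hits c c' e x y : G e.1 e.2 -> (L <= c)%N ->
  iter c op (fun e3 => iter c' op
    (fun e4 => (e3.2 == x)%:R * (e4.2 == y)%:R) e3) e <=
  2 * A / n * ker c' x y.
Proof.
move=> Ge Lc.
apply: (@le_trans _ _ (iter c op (fun e3 => ker c' x y * (e3.2 == x)%:R) e)).
  apply: iter_nbw_op_le => // e3 Ge3; rewrite iter_nbw_opZ mulrC.
  case: eqP => [<-|_]; last by rewrite !mulr0.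
  by rewrite !mulr1; exact: nbw_hit_le.
by rewrite iter_nbw_opZ mulrC ler_wpM2r ?nbw_kernel_ge0 ?hit_mixed.
Qed.

(** Here e1 and e2 are the edges at the two early times and e3, e4 those at the
    two late times. The late vertices x and y are the early ones in one order
    or the other, hence the assumption on the kernel, which is symmetric. *)
Lemma iter_four_times a b c c' e (F : V * V -> V * V -> V * V -> V * V -> R) :
  G e.1 e.2 -> (L <= c)%N ->
  (forall e1 e2, G e1.1 e1.2 -> G e2.1 e2.2 ->
     exists x y, ker c' x y = ker c' e1.2 e2.2 /\
     forall e3 e4, G e3.1 e3.2 -> G e4.1 e4.2 ->
       F e1 e2 e3 e4 = (e3.2 == x)%:R * (e4.2 == y)%:R) ->
  iter a op (fun e1 => iter b op (fun e2 => iter c op (fun e3 => iter c' op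
    (F e1 e2 e3) e3) e2) e1) e <=
  2 * A / n * (2 * (A / n + A * (tau ^+ b * tau ^+ c'))).
Proof.
move=> Ge Lc FE; apply: (iter_nbw_op_le_const Greg d3) => // e1 Ge1.
apply: (@le_trans _ _ (iter b op (fun e2 => 2 * A / n * ker c' e1.2 e2.2) e1)).
  apply: iter_nbw_op_le => // e2 Ge2; have [x [y [<- {}FE]]] := FE e1 e2 Ge1 Ge2.
  apply: le_trans (iter_two_hits c' x y Ge2 Lc).
  apply: iter_nbw_op_le => // e3 Ge3; apply: iter_nbw_op_le => // e4 Ge4.
  by rewrite FE.
rewrite iter_nbw_opZ (iter_nbw_op_hit _ _ _ (fun y => ker c' e1.2 y)).
rewrite ler_wpM2l ?mulr_ge0 //; exact: sum_hit_kernel.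
Qed.

(** All sampled times are even, so that coincidences have positive probability
    in a bipartite graph as well, and every late time exceeds every early one
    by more than 2 L steps. *)
Definition first_time (i : 'I_L) : nat := i.*2.
Definition second_time (k : 'I_L) : nat := (4 * L + k.*2)%N.

Definition crossing (x : V) (l : seq V) (p : 'I_L * 'I_L) : R :=
  (path_at x l (first_time p.1) == path_at x l (second_time p.2))%:R.

Lemma crossing_mean e p : G e.1 e.2 ->
  (2 * n)^-1 <= nbw_exp G d (6 * L) e (fun l => crossing e.2 l p).
Proof.
case: p => i k Ge; pose m := (2 * L + k - i).-1.
have iL := ltn_ord i; have kL := ltn_ord k.
have -> : (6 * L = i.*2 + (m.*2.+2 + (2 * L - k.*2)))%N by rewrite /m; lia.
have st : second_time k = (i.*2 + m.*2.+2)%N by rewrite /second_time /m; lia.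
rewrite /crossing /= st.
rewrite (nbw_exp_times2 _ _ _ _ _ _ (fun x y => (x == y)%:R)).
rewrite -(iter_nbw_op_const Greg d3 i.*2 (2 * n)^-1 Ge).
apply: iter_nbw_op_le => // e1 Ge1.
rewrite (eq_iter_nbw_op d3 _ (psi := fun e2 => (e2.2 == e1.2)%:R)) //; last first.
  by move=> e2 Ge2; rewrite nbw_exp_const // eq_sym.
apply: le_trans (return_lb m Ge1).
have : A * tau ^+ m.*2.+2 <= (16 * n)^-1.
  by apply: le_trans L_mix; apply: tau_le; rewrite /m; lia.
rewrite !invfM; have := nV0; lra.
Qed.

Definition gap_of (i j : 'I_L) : nat := (i - j + (j - i))%N.

(** Up to exchanging the two pairs, the early times are in increasing order;
    the late times are then in the same or in the opposite order. *)
Lemma crossing_pair e p p' : G e.1 e.2 ->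
  nbw_exp G d (6 * L) e (fun l => crossing e.2 l p * crossing e.2 l p') <=
  2 * A / n *
    (2 * (A / n + A * (tau ^+ gap_of p.1 p'.1 * tau ^+ gap_of p.2 p'.2))).
Proof.
move=> Ge.
wlog ii' : p p' / (p.1 <= p'.1)%N.
  move=> H; have [/H//|/ltnW/H] := leqP p.1 p'.1.
  rewrite /gap_of addnC [X in _ * tau ^+ X]addnC.
  under eq_nbw_exp do rewrite mulrC.
  exact.
case: p p' ii' => i k [i' k'] /= ii'.
have iL := ltn_ord i; have kL := ltn_ord k.
have i'L := ltn_ord i'; have k'L := ltn_ord k'.
pose b := (i' - i).*2.
have b_gap c : (gap_of k k' <= c)%N -> 
    2 * A / n * (2 * (A / n + A * (tau ^+ b * tau ^+ c))) <=
    2 * A / n * (2 * (A / n + A * (tau ^+ gap_of i i' * tau ^+ gap_of k k'))).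
  move=> gc; rewrite !ler_wpM2l ?mulr_ge0 // lerD2l -!exprD tau_le //.
  by rewrite leq_add // /gap_of /b; move: ii'; clear; lia.
have [kk'|/ltnW k'k] := leqP k k'.
- pose c := (4 * L + k.*2 - i'.*2)%N; pose c' := (k' - k).*2.
  have -> : (6 * L = i.*2 + (b + (c + (c' + (2 * L - k'.*2)))))%N.
    by rewrite /b /c /c'; lia.
  have t2 : i'.*2 = (i.*2 + b)%N by rewrite /b; lia.
  have t3 : (4 * L + k.*2 = i.*2 + b + c)%N by rewrite /b /c; lia.
  have t4 : (4 * L + k'.*2 = i.*2 + b + c + c')%N by rewrite /b /c /c'; lia.
  rewrite /crossing /first_time /second_time /= t2 t3 t4.
  rewrite (nbw_exp_times4 _ _ _ _ _ _ _ _
    (fun x y z w => (x == z)%:R * (y == w)%:R)).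
  apply: le_trans (b_gap c' _); last by rewrite /c' /gap_of; lia.
  apply: iter_four_times => //; first by rewrite /c; move: i'L; clear; lia.
  move=> e1 e2 _ _; exists e1.2, e2.2; split=> // e3 e4 _ Ge4.
  by rewrite nbw_exp_const // eq_sym [e2.2 == _]eq_sym.
- pose c := (4 * L + k'.*2 - i'.*2)%N; pose c' := (k - k').*2.
  have -> : (6 * L = i.*2 + (b + (c + (c' + (2 * L - k.*2)))))%N.
    by rewrite /b /c /c'; lia.
  have t2 : i'.*2 = (i.*2 + b)%N by rewrite /b; lia.
  have t3 : (4 * L + k'.*2 = i.*2 + b + c)%N by rewrite /b /c; lia.
  have t4 : (4 * L + k.*2 = i.*2 + b + c + c')%N by rewrite /b /c /c'; lia.
  rewrite /crossing /first_time /second_time /= t2 t3 t4.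
  rewrite (nbw_exp_times4 _ _ _ _ _ _ _ _
    (fun x y z w => (x == w)%:R * (y == z)%:R)).
  apply: le_trans (b_gap c' _); last by rewrite /c' /gap_of; lia.
  apply: iter_four_times => //; first by rewrite /c; move: i'L; clear; lia.
  move=> e1 e2 _ _; exists e2.2, e1.2; split=> // e3 e4 _ Ge4.
  by rewrite nbw_exp_const // mulrC eq_sym [e1.2 == _]eq_sym.
Qed.

Lemma sum_gap (i : 'I_L) : \sum_(j < L) tau ^+ gap_of i j <= 2 / (1 - tau).
Proof.
have iL := ltn_ord i.
rewrite -(big_mkord xpredT (fun j => tau ^+ (i - j + (j - i)))).
rewrite (big_cat_nat (n := i)) //=; last exact: ltnW.
rewrite mulr_natl mulr2n; apply: lerD.
  apply: le_trans (geometric_sum_le i (ltW tau0) tau1).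
  rewrite big_nat_rev big_mkord.
  apply: ler_sum => j _; rewrite ler_wiXn2l ?ltW //.
  by have := ltn_ord j; clear; lia.
rewrite -[X in \sum_(X <= _ < _) _]add0n big_addn big_mkord.
apply: le_trans (geometric_sum_le (L - i) (ltW tau0) tau1).
apply: ler_sum => j _.
by rewrite ler_wiXn2l ?ltW //; clear; lia.
Qed.

Definition crossings x l := \sum_p crossing x l p.

Lemma crossings_mean e : G e.1 e.2 ->
  L%:R ^+ 2 / (2 * n) <= nbw_exp G d (6 * L) e (crossings e.2).
Proof.
move=> Ge; rewrite /crossings nbw_exp_sum.
apply: le_trans (ler_sum _ (fun p _ => crossing_mean p Ge)).
by rewrite sumr_const card_prod card_ord -[leRHS]mulr_natl natrM -expr2.
Qed.

Definition second_moment_const : R := 4 * A ^+ 2 * (1 + 4 / (1 - tau) ^+ 2).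

Lemma second_moment_const_gt0 : 0 < second_moment_const.
Proof.
have t1 : 0 < 1 - tau by rewrite subr_gt0.
have A_gt0 : 0 < A by apply: lt_le_trans A1.
by rewrite !mulr_gt0 ?exprn_gt0 // addr_gt0 // divr_gt0 // exprn_gt0.
Qed.

(** The sum over pairs of pairs of tau ^ b * tau ^ c factors into the square of
    S, which is of order L; since L ^ 2 >= n the resulting L ^ 2 / n is
    absorbed in (L ^ 2 / n) ^ 2. *)
Lemma crossings_second_moment e : G e.1 e.2 ->
  nbw_exp G d (6 * L) e (fun l => crossings e.2 l ^+ 2) <=
  second_moment_const * (L%:R ^+ 2 / n) ^+ 2.
Proof.
move=> Ge; have t1 : 0 < 1 - tau by rewrite subr_gt0.
have n0 : 0 < n by rewrite ltr0n; apply/card_gt0P; exists e.1.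
have L0 : 0 < L%:R ^+ 2 :> R by apply: lt_le_trans L_large.
under eq_nbw_exp do rewrite expr2 big_distrlr.
rewrite nbw_exp_sum.
apply: (@le_trans _ _ (\sum_p \sum_p'
    2 * A / n *
    (2 * (A / n + A * (tau ^+ gap_of p.1 p'.1 * tau ^+ gap_of p.2 p'.2))))).
  apply: ler_sum => p _; rewrite nbw_exp_sum; apply: ler_sum => p' _.
  exact: crossing_pair.
pose S := \sum_(i < L) \sum_(j < L) tau ^+ gap_of i j.
have S0 : 0 <= S by apply: sumr_ge0 => i _; apply: sumr_ge0.
have S_ub : S <= L%:R * (2 / (1 - tau)).
  apply: le_trans (ler_sum _ (fun i _ => sum_gap i)) _.
  by rewrite sumr_const card_ord -[leLHS]mulr_natl.
have SS : \sum_(p : 'I_L * 'I_L) \sum_(p' : 'I_L * 'I_L)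
    tau ^+ gap_of p.1 p'.1 * tau ^+ gap_of p.2 p'.2 = S ^+ 2.
  rewrite expr2 /S big_distrlr [RHS]pair_bigA /=; apply: eq_bigr => p _.
  by rewrite big_distrlr pair_bigA.
have -> : \sum_p \sum_p'
    2 * A / n *
    (2 * (A / n + A * (tau ^+ gap_of p.1 p'.1 * tau ^+ gap_of p.2 p'.2)))
    = 4 * A ^+ 2 / n * (L%:R ^+ 4 / n + S ^+ 2).
  rewrite -SS.
  transitivity (4 * A ^+ 2 / n *
    \sum_(p : 'I_L * 'I_L) \sum_(p' : 'I_L * 'I_L)
      (n^-1 + tau ^+ gap_of p.1 p'.1 * tau ^+ gap_of p.2 p'.2)).
    rewrite mulr_sumr; apply: eq_bigr => p _; rewrite mulr_sumr.
    by apply: eq_bigr => p' _; ring.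
  congr (_ * _); under eq_bigr do rewrite big_split /=.
  rewrite big_split /= !sumr_const card_prod card_ord -mulrnA.
  by rewrite -[n^-1 *+ _]mulr_natl !natrM !exprS expr0 mulr1 !mulrA.
have S2 : S ^+ 2 <= L%:R ^+ 2 * (4 / (1 - tau) ^+ 2).
  have := ler_pM S0 S0 S_ub S_ub; rewrite -!expr2 exprMn expr_div_n.
  by rewrite (_ : 2 ^+ 2 = 4 :> R) //; ring.
have Ln : 1 <= L%:R ^+ 2 / n by rewrite ler_pdivlMr // mul1r.
have K0 : 0 <= 4 * A ^+ 2 / n by rewrite !mulr_ge0 ?sqr_ge0.
apply: le_trans (_ : 4 * A ^+ 2 / n * (L%:R ^+ 4 / n + 
   L%:R ^+ 2 * (L%:R ^+ 2 / n) * (4 / (1 - tau) ^+ 2)) <= _).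
  rewrite ler_wpM2l // lerD2l; apply: le_trans S2 _.
  by rewrite ler_wpM2r ?divr_ge0 ?sqr_ge0 // -[leLHS]mulr1 ler_wpM2l ?sqr_ge0.
rewrite /second_moment_const le_eqVlt; apply/orP; left; apply/eqP; field.
by rewrite !gt_eqF.
Qed.

Lemma crossings_uniq x l :
  size l = (6 * L)%N -> uniq (x :: l) -> crossings x l = 0.
Proof.
move=> sz ul; rewrite /crossings big1 // => -[i k] _; rewrite /crossing /=.
have [iL kL] := (ltn_ord i, ltn_ord k).
have b1 : (first_time i <= size l)%N.
  by rewrite sz /first_time; move: iL; clear; lia.
have b2 : (second_time k <= size l)%N.
  by rewrite sz /second_time; move: kL; clear; lia.
rewrite !path_at_nth // nth_uniq ?ltnS //.
have -> : (first_time i == second_time k) = false; last by [].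
by apply/negP => /eqP; rewrite /first_time /second_time; move: iL; clear; lia.
Qed.

(** For every lam, 1 - (1 - lam N) ^ 2 is at most the indicator of N > 0.
    Taking expectations, and lam optimal for the bounds on the two moments of
    N, yields the Paley-Zygmund bound from linearity alone. *)
Lemma block_uniq_ub e : G e.1 e.2 ->
  nbw_exp G d (6 * L) e (fun l => (uniq (e.2 :: l))%:R) <=
  1 - (4 * second_moment_const)^-1.
Proof.
move=> Ge; have t1 : 0 < 1 - tau by rewrite subr_gt0.
have n0 : 0 < n by rewrite ltr0n; apply/card_gt0P; exists e.1.
have L0 : 0 < L%:R ^+ 2 :> R by apply: lt_le_trans L_large.
pose S := second_moment_const.
have S0 : 0 < S := second_moment_const_gt0.
pose r := L%:R ^+ 2 / n; have r0 : 0 < r by rewrite divr_gt0.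
pose lam := (2 * S * r)^-1.
have lam0 : 0 < lam by rewrite invr_gt0; do 2! [apply: mulr_gt0 => //].
apply: (@le_trans _ _ (nbw_exp G d (6 * L) e (fun l =>
    1 + (- (2 * lam) * crossings e.2 l + lam ^+ 2 * crossings e.2 l ^+ 2)))).
  apply: nbw_exp_le => // l sz; have [ul|_] := boolP (uniq _).
    by rewrite crossings_uniq // expr0n /= !mulr0 !addr0.
  have := sqr_ge0 (1 - lam * crossings e.2 l); rewrite sqrrB exprMn expr1n.
  by rewrite mul1r mulr0n -mulr_natl; lra.
rewrite nbw_expD nbw_expD !nbw_expZ nbw_exp_const //.
have m1 := crossings_mean Ge; have m2 := crossings_second_moment Ge.
have {}m1 : lam * r <= 2 * lam * nbw_exp G d (6 * L) e (crossings e.2).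
  apply: le_trans (ler_wpM2l _ m1); last by rewrite mulr_ge0 // ltW.
  by rewrite le_eqVlt /r; apply/orP; left; apply/eqP; field; rewrite gt_eqF.
have := ler_wpM2l (sqr_ge0 lam) m2; rewrite -/S -/r => {}m2.
have E : lam * r - lam ^+ 2 * (S * r ^+ 2) = (4 * S)^-1.
  by rewrite /lam; field; rewrite !gt_eqF.
rewrite -E mulNr; lra.
Qed.

End BlockIntersection.

(** * The self-intersection time as a sum of tails *)

(** Shifting the index by H bounds the sum by H plus 1 - p times itself. *)
Lemma contracting_sum_le (R : realType) (a : nat -> R) (H : nat) (p : R) :
  0 < p -> (forall t, 0 <= a t) -> (forall t, a t <= 1) ->
  (forall t, a (t + H)%N <= (1 - p) * a t) ->
  forall N, \sum_(t < N) a t <= H%:R / p.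
Proof.
move=> p0 a0 a1 aH N; rewrite ler_pdivlMr //.
have : \sum_(0 <= t < N) a t <= \sum_(0 <= t < N + H) a t.
  by rewrite [leRHS](big_cat_nat (n := N)) ?leq_addr //= lerDl sumr_ge0.
rewrite [X in _ <= X -> _](big_cat_nat (n := H)) ?leq_addl //=.
rewrite -{2}[H]add0n big_addn addnK !big_mkord.
have : \sum_(t < N) a (t + H)%N <= (1 - p) * \sum_(t < N) a t.
  by rewrite mulr_sumr; apply: ler_sum => t _; exact: aH.
have : \sum_(t < H) a t <= H%:R.
  rewrite -[leRHS]mulr1 mulr_natl -[in leRHS](card_ord H) -sumr_const.
  exact: ler_sum.
lra.
Qed.

Lemma nneseries_le_bound (R : realType) (u : nat -> \bar R) (B : \bar R) :
  (forall t, 0 <= u t)%E -> (forall N, \sum_(t < N) u t <= B)%E ->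
  (\sum_(0 <= t <oo) u t <= B)%E.
Proof.
move=> u0 uB; apply: lime_le; first by apply: is_cvg_nneseries => *; exact: u0.
by apply: nearW => N; rewrite big_mkord.
Qed.

Section SelfIntersection.

Variables (R : realType) (Omega : Type) (V : finType) (X : nat -> Omega -> V).

(** The event that the self-intersection time exceeds t. Times below 2 are left
    unconstrained to agree with the definition of that time even where the
    trajectory is not a path of the graph. *)
Definition no_hit (t : nat) (w : Omega) : bool :=
  [forall i : 'I_t.+1, forall j : 'I_i, (2 <= i)%N ==> (X i w != X j w)].

Lemma no_hitP t w :
  reflect (forall i j, (2 <= i <= t)%N -> (j < i)%N -> X i w <> X j w)
          (no_hit t w).
Proof.
apply: (iffP forallP) => [H i j /andP[i2 it] ji | H i].
  have := forallP (H (Ordinal (it : (i < t.+1)%N))) (Ordinal ji).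
  by rewrite /= i2 /= => /eqP.
apply/forallP => j; apply/implyP => i2; apply/eqP; apply: H => //.
by rewrite i2 -ltnS /=.
Qed.

(** The pointwise tail-sum formula; it also reduces the measurability of the
    time to that of the events [no_hit]. *)
Lemma self_intersection_time_series w :
  self_intersection_time R X w =
  (\sum_(0 <= t <oo) ((no_hit t w)%:R : R)%:E)%E.
Proof.
pose hit t := (2 <= t)%N && [exists j : 'I_t, X t w == X j w].
have hitP t : hit t <-> (2 <= t)%N /\ exists2 j, (j < t)%N & X t w = X j w.
  split=> [/andP[-> /existsP[j /eqP e]]|[t2 [j jt e]]].
    by split=> //; exists j.
  by rewrite /hit t2; apply/existsP; exists (Ordinal jt); apply/eqP.
have u0 t : (0 <= ((no_hit t w)%:R : R)%:E)%E by rewrite lee_fin ler0n.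
have no_hitE t : no_hit t w = [forall i : 'I_t.+1, ~~ hit i].
  apply/no_hitP/forallP => [H i|H i j /andP[i2 it] ji e].
    by apply/negP => /hitP[i2 [j ji]]; apply: H; rewrite // i2 -ltnS /=.
  have /negP := H (Ordinal (it : (i < t.+1)%N)); apply; apply/hitP => /=.
  by split=> //; exists j.
have [ex|nex] := pselect (exists t, hit t).
  case: (ex_minnP ex) => T hitT minT.
  have {}no_hitE t : no_hit t w = (t < T)%N.
    rewrite no_hitE; apply/forallP/idP => [H|tT i].
      rewrite ltnNge -ltnS; apply/negP => Tt.
      by have := H (Ordinal Tt); rewrite hitT.
    apply/negP => /minT; rewrite leqNgt => /negP; apply.
    exact: leq_trans (ltn_ord i) tT.
  have partial N : (\sum_(t < N) ((no_hit t w)%:R : R)%:E = (minn N T)%:R%:E)%E.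
    rewrite sumEFin; congr (_%:E); elim: N => [|N IH].
      by rewrite big_ord0 min0n.
    rewrite big_ord_recr /= IH no_hitE -natrD; congr (_%:R).
    by move: (N < T)%N (@ltnP N T) => [] [] h; clear -h; lia.
  apply/le_anti/andP; split.
    apply: (@le_trans _ _ (T%:R%:E)).
      apply: ereal_inf_lbound; exists T => //; exact/hitP.
    have := @nneseries_lim_ge R (fun t => ((no_hit t w)%:R : R)%:E) xpredT 0 T
      (fun t _ _ => u0 t).
    by rewrite big_mkord partial minnn.
  apply: (@le_trans _ _ (T%:R%:E)).
    by apply: nneseries_le_bound => // N; rewrite partial lee_fin ler_nat geq_minr.
  by apply: le_ereal_inf_tmp => _ [t /hitP/minT Tt <-]; rewrite lee_fin ler_nat.
transitivity (+oo%E : \bar R).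
  rewrite /self_intersection_time (_ : [set _ | _ in _] = set0) ?ereal_inf0 //.
  by apply/seteqP; split=> // z [t /= /hitP ht _]; apply: nex; exists t.
apply: esym; apply/eqyP => B _.
have := @nneseries_lim_ge R (fun t => ((no_hit t w)%:R : R)%:E) xpredT 0
  (Num.truncn B).+1 (fun t _ _ => u0 t).
apply: le_trans; rewrite big_mkord sumEFin lee_fin (eq_bigr (fun=> 1)) => [|t _].
  by rewrite sumr_const card_ord ltW // truncnS_gt.
rewrite (_ : no_hit t w) // no_hitE; apply/forallP => i; apply/negP => hi.
by apply: nex; exists i.
Qed.

End SelfIntersection.

(** * Law of the walk on cylinder events *)

Section WalkLaw.

Variables (R : realType) (V : finType) (G : sgraph V) (d : nat) (u : V).
Hypothesis Greg : regular_graph G d.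
Variables (disp : measure_display) (Omega : measurableType disp).
Variables (P : probability Omega R) (X : nat -> Omega -> V).
Hypothesis Xnbw : is_nbw G u P X.

Lemma measurable_bool_event (T : finType) (Y : Omega -> T) (B : pred T) :
  (forall y, measurable [set w | Y w = y]) -> measurable [set w | B (Y w)].
Proof.
move=> mY; rewrite (_ : mkset _ = \big[setU/set0]_(y | B y) [set w | Y w = y]).
  exact: bigsetU_measurable.
rewrite -bigcup_seq_cond; apply/seteqP; split=> w /=.
  by move=> Bw; exists (Y w) => //=; rewrite mem_index_enum.
by case=> y /=; case/andP=> _ By ->.
Qed.

Lemma probability_partition (T : finType) (Y : Omega -> T) (A : set Omega) :
  (forall y, measurable [set w | Y w = y]) -> measurable A ->
  P A = (\sum_y P (A `&` [set w | Y w = y]))%E.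
Proof.
move=> mY mA.
have mAY y : measurable (A `&` [set w | Y w = y]) by exact: measurableI.
transitivity (P (\bigcup_(y in [set: T]) (A `&` [set w | Y w = y]))).
  congr (P _); apply/seteqP; split=> w /=; last by case=> y _ [].
  by move=> Aw; exists (Y w).
rewrite measure_fin_bigcup //; last 2 first.
- exact: finite_finset.
- by move=> y z _ _ [w [[_ /= <-] [_ /= <-]]].
rewrite (fsbigE (index_enum T)) ?index_enum_uniq //; last first.
  by move=> y _; rewrite mem_index_enum.
by apply: eq_bigl => y; rewrite in_setT.
Qed.

Definition trajectory (m k : nat) (w : Omega) : seq V :=
  [seq X i w | i <- iota m k].

Definition cylinder (l : seq V) : set Omega :=
  [set w | trajectory 0 (size l) w = l].

Lemma size_trajectory m k w : size (trajectory m k w) = k.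
Proof. by rewrite size_map size_iota. Qed.

Lemma trajectory_rcons m k w :
  trajectory m k.+1 w = rcons (trajectory m k w) (X (m + k)%N w).
Proof. by rewrite /trajectory -addn1 iotaD map_cat cats1. Qed.

Lemma nth_trajectory m k w i : (i < k)%N ->
  nth u (trajectory m k w) i = X (m + i)%N w.
Proof. by move=> ik; rewrite (nth_map 0%N) ?size_iota // nth_iota. Qed.

Lemma measurable_trajectory_eq m k l : measurable [set w | trajectory m k w = l].
Proof.
elim: k m l => [|k IH] m [|z l].
- by rewrite (_ : mkset _ = setT) //; apply/seteqP; split.
- by rewrite (_ : mkset _ = set0) //; apply/seteqP; split.
- by rewrite (_ : mkset _ = set0) //; apply/seteqP; split.
rewrite (_ : mkset _ = [set w | X m w = z] `&` [set w | trajectory m.+1 k w = l]).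
  by apply: measurableI => //; exact: (nbw_measurable Xnbw).
by apply/seteqP; split=> w; rewrite /trajectory /= => -[-> ->].
Qed.

Lemma measurable_trajectory_event m k (B : pred (seq V)) :
  measurable [set w | B (trajectory m k w)].
Proof.
pose Y w : k.-tuple V := Tuple (introT eqP (size_trajectory m k w)).
apply: (@measurable_bool_event _ Y (fun l : k.-tuple V => B l)) => l.
rewrite (_ : mkset _ = [set w | trajectory m k w = l]).
  exact: measurable_trajectory_eq.
by apply/seteqP; split=> w /=; [move=> <- | move=> e; exact: val_inj].
Qed.

Lemma past_cylinder h l t : size l = t.+1 ->
  (forall s, (s <= t)%N -> h s = nth u l s) -> past X h t = cylinder l.
Proof.
move=> sz hl; rewrite /past /cylinder sz; apply/seteqP; split=> w /= H.
  apply: (@eq_from_nth _ u); rewrite size_trajectory // => s st.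
  by rewrite nth_trajectory // H // hl.
by move=> s st; rewrite hl // -H nth_trajectory.
Qed.

(** The trajectory is written as a list with its last two entries apart, since
    they determine the law of the next step. *)
Lemma cylinder_step l w x z : G w x ->
  P (cylinder (rcons (rcons (rcons l w) x) z)) =
  (P (cylinder (rcons (rcons l w) x)) *
    ((G x z && (z != w))%:R / (d%:R - 1))%:E)%E.
Proof.
move=> Gwx; pose h := nth u (rcons (rcons (rcons l w) x) z).
have hw : h (size l) = w.
  by rewrite /h !nth_rcons !size_rcons ltnS leqnSn ltnSn ltnn eqxx.
have hx : h (size l).+1 = x by rewrite /h !nth_rcons !size_rcons ltnSn ltnn eqxx.
have hz : h (size l).+2 = z by rewrite /h !nth_rcons !size_rcons ltnn eqxx.
have := nbw_step Xnbw h (size l).+1; rewrite hz.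
rewrite (@past_cylinder _ (rcons (rcons (rcons l w) x) z)) ?size_rcons //.
rewrite (@past_cylinder _ (rcons (rcons l w) x)) ?size_rcons //; last first.
  by move=> s sl; rewrite /h nth_rcons !size_rcons ltnS sl.
move=> ->; rewrite /uniform_on /= hx hw !inE andbC.
have wx : w \in nbhd G x by rewrite inE adj_sym.
have := cardsD1 w (nbhd G x); rewrite wx Greg => ->.
by rewrite natrD addrAC subrr add0r.
Qed.

(** The conditional laws of different steps agree with [nbw_op] only along
    edges of the graph; other cylinders are negligible. *)
Lemma cylinder_nonedge l w x : ~~ G w x ->
  P (cylinder (rcons (rcons l w) x)) = 0%E.
Proof.
move=> Gwx; pose h := nth u (rcons (rcons l w) x).
have hw : h (size l) = w by rewrite /h !nth_rcons !size_rcons ltnSn ltnn eqxx.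
have hx : h (size l).+1 = x by rewrite /h !nth_rcons !size_rcons ltnn eqxx.
have := nbw_step Xnbw h (size l); rewrite hx.
rewrite (@past_cylinder _ (rcons (rcons l w) x)) ?size_rcons // => ->.
rewrite /uniform_on (_ : x \in _ = false) ?mul0r ?mule0 //.
by case: (size l) hw => [|s] /= ->; rewrite !inE (negPf Gwx) ?andbF.
Qed.

(** Induction on the number of steps, splitting according to the next vertex:
    this identifies the conditional law on the probability space with the
    recursive expectation [nbw_exp]. *)
Lemma cylinder_conditional k l w x (B : pred (seq V)) : G w x ->
  P (cylinder (rcons (rcons l w) x) `&`
       [set om | B (trajectory (size l).+2 k om)]) =
  (P (cylinder (rcons (rcons l w) x)) *
    (nbw_exp G d k (w, x) (fun m => (B m)%:R))%:E)%E.
Proof.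
elim: k l w x B => [|k IH] l w x B Gwx.
  rewrite /trajectory /=; case: (B [::]).
    by rewrite (_ : mkset _ = setT) ?setIT ?mule1 //; apply/seteqP; split.
  by rewrite (_ : mkset _ = set0) ?setI0 ?measure0 ?mule0 //; apply/seteqP; split.
have mc := measurable_trajectory_eq 0.
rewrite (@probability_partition _ (X (size l).+2)); last 2 first.
- by move=> y; exact: (nbw_measurable Xnbw).
- by apply: measurableI; [exact: mc | exact: measurable_trajectory_event].
have cylE z : cylinder (rcons (rcons (rcons l w) x) z) =
    cylinder (rcons (rcons l w) x) `&` [set om | X (size l).+2 om = z].
  rewrite /cylinder /mkset !size_rcons.
  apply/seteqP; split=> om; rewrite trajectory_rcons.
    by move=> /eqP; rewrite eqseq_rcons => /andP[/eqP e1 /eqP e2]; split.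
  by case=> -> <-.
transitivity (\sum_z (P (cylinder (rcons (rcons l w) x)) *
    ((G x z && (z != w))%:R / (d%:R - 1) *
       nbw_exp G d k (x, z) (fun m => (B (z :: m))%:R))%:E))%E.
  apply: eq_bigr => z _.
  rewrite (_ : _ `&` _ `&` _ = cylinder (rcons (rcons (rcons l w) x) z) `&`
      [set om | B (z :: trajectory (size (rcons l w)).+2 k om)]).
    have [Gxz|nGxz] := boolP (G x z).
      rewrite (IH (rcons l w) x z (fun m => B (z :: m)) Gxz) cylinder_step //.
      by rewrite Gxz -muleA -EFinM.
    rewrite andFb !mul0r mule0; apply/eqP; rewrite eq_le measure_ge0 andbT.
    rewrite -(cylinder_nonedge (rcons l w) nGxz); apply: le_measure; rewrite ?inE.
    + apply: measurableI; first exact: mc.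
      exact: (measurable_trajectory_event _ _ (fun m => B (z :: m))).
    + exact: mc.
    + exact: subIsetl.
  rewrite cylE size_rcons /trajectory; apply/seteqP; split=> om /=.
    by case=> -[c Bo] <-.
  by case=> -[c <-] Bo.
set c := cylinder _.
have /fineK <- : P c \is a fin_num by apply: fin_num_measure; exact: mc.
under eq_bigr do rewrite -EFinM.
rewrite sumEFin -EFinM -mulr_sumr; congr (_ * _)%:E.
rewrite /= mulr_sumr [RHS]big_mkcond; apply: eq_bigr => z _.
by case: (G x z && (z != w)); rewrite ?mul0r // mul1r.
Qed.

End WalkLaw.

(** * Geometric tail of the self-intersection time *)

Section ExpectedTime.

Variables (R : realType) (V : finType) (G : sgraph V) (d : nat) (u : V).
Hypothesis Greg : regular_graph G d.
Variables (disp : measure_display) (Omega : measurableType disp).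
Variables (P : probability Omega R) (X : nat -> Omega -> V).
Hypothesis Xnbw : is_nbw G u P X.
Variables (H : nat) (p : R).
Hypothesis p0 : 0 < p.
Hypothesis block : forall e, G e.1 e.2 ->
  nbw_exp G d H e (fun l => (uniq (e.2 :: l))%:R) <= 1 - p.

Definition no_hit_event t : set Omega := [set w | no_hit X t w].

Lemma no_hit_trajectory t w w' :
  trajectory X 0 t.+1 w = trajectory X 0 t.+1 w' ->
  no_hit X t w -> no_hit X t w'.
Proof.
move=> e; have eX i : (i <= t)%N -> X i w = X i w'.
  move=> it; have nE v := @nth_trajectory V u _ Omega X 0 t.+1 v i.
  by have := nE w it; rewrite e nE // add0n => ->.
move=> /no_hitP h; apply/no_hitP => i j /andP[i2 it] ji.
by rewrite -!eX ?(ltnW (leq_trans ji it)) //; apply: h; rewrite ?i2.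
Qed.

Lemma measurable_no_hit_event t : measurable (no_hit_event t).
Proof.
pose B (l : seq V) : bool :=
  `[< exists2 w, trajectory X 0 t.+1 w = l & no_hit X t w >].
rewrite (_ : no_hit_event t = [set w | B (trajectory X 0 t.+1 w)]).
  exact: (measurable_trajectory_event Xnbw).
apply/seteqP; split=> w /= => [h|/asboolP[w' e]]; last exact: no_hit_trajectory.
by apply/asboolP; exists w.
Qed.

(** The block begins at a positive time, so that coincidences inside it happen
    at times at least 2 and count as self-intersections. *)
Lemma no_hit_block_uniq t w : no_hit X (t.+1 + H) w ->
  uniq (X t.+1 w :: trajectory X t.+2 H w).
Proof.
move=> /no_hitP h; rewrite -[_ :: _]/(trajectory X t.+1 H.+1 w).
rewrite map_inj_in_uniq ?iota_uniq // => i j; rewrite !mem_iota.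
wlog ij : i j / (i <= j)%N.
  by move=> W hi hj e; have [/W|/ltnW/W] := leqP i j; [apply|move=> ->].
rewrite leq_eqVlt in ij; case/predU1P: ij => // ij hi hj e.
case: (h j i) => //; move: ij hi hj; clear; lia.
Qed.

(** The event at time t.+1 is a union of cylinders; on each of them, the later
    event forces the next H steps to be a self-avoiding block, whose
    conditional probability is at most 1 - p. *)
Lemma no_hit_block_contraction t :
  (P (no_hit_event (t.+1 + H)) <= (1 - p)%:E * P (no_hit_event t.+1))%E.
Proof.
pose Y w : t.+2.-tuple V := Tuple (introT eqP (size_trajectory X 0 t.+2 w)).
have YE (l : t.+2.-tuple V) : [set w | Y w = l] = cylinder X l.
  rewrite /cylinder size_tuple; apply/seteqP; split=> w /=; first by move=> <-.
  by move=> e; exact: val_inj.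
have mY l : measurable [set w | Y w = l].
  by rewrite YE; exact: (measurable_trajectory_eq Xnbw).
have mS := measurable_no_hit_event.
rewrite (probability_partition P mY (mS _)).
rewrite [in leRHS](probability_partition P mY (mS _)).
rewrite ge0_sume_distrr //; apply: lee_sum => l _; rewrite YE.
have [[w0 Yw0 h0]|none] :=
  pselect (exists2 w, cylinder X l w & no_hit X t.+1 w); last first.
  rewrite [X in P X](_ : _ = set0) ?measure0.
    rewrite [X in P X](_ : _ = set0) ?measure0 ?mule0 //.
    by apply/seteqP; split=> // w [h Yw]; apply: none; exists w.
  apply/seteqP; split=> // w [/no_hitP h Yw]; apply: none; exists w => //.
  apply/no_hitP => i j /andP[i2 it]; apply: h; rewrite i2 /=.
  by apply: leq_trans it _; rewrite leq_addr.
rewrite [X in (_ <= _ * P X)%E](_ : _ = cylinder X l); last first.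
  apply/seteqP; split=> [w []//|w Yw]; split=> //.
  apply: no_hit_trajectory h0; move: Yw0 Yw.
  by rewrite /cylinder /= size_tuple => -> ->.
have : size l = t.+2 by rewrite size_tuple.
case/lastP: (tval l) => // l1 x; rewrite size_rcons => -[].
case/lastP: l1 => // l0 w; rewrite size_rcons => -[sz].
set c := cylinder _ _.
have mc : measurable c by exact: (measurable_trajectory_eq Xnbw).
have mS' : measurable (no_hit_event (t.+1 + H) `&` c) by exact: measurableI.
have [Gwx|nGwx] := boolP (G w x); last first.
  have c0 : P c = 0%E by exact: (cylinder_nonedge Xnbw).
  rewrite c0 mule0 -c0; apply: le_measure; rewrite ?inE //; exact: subIsetr.
have := cylinder_conditional Greg Xnbw H l0 (fun m => uniq (x :: m)) Gwx.
rewrite -/c sz => E.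
apply: (@le_trans _ _ (P (c `&` [set om | uniq (x :: trajectory X t.+2 H om)]))).
  apply: le_measure; rewrite ?inE //.
    apply: measurableI => //.
    exact: (measurable_trajectory_event Xnbw _ _ (fun m => uniq (x :: m))).
  move=> om [h com]; split=> //=; have := no_hit_block_uniq h.
  suff -> : X t.+1 om = x by [].
  rewrite -[t.+1]add0n -(@nth_trajectory _ u _ _ X 0 t.+2) //.
  move: com; rewrite /c /cylinder /mkset !size_rcons sz => ->.
  by rewrite nth_rcons size_rcons sz ltnn eqxx.
rewrite E muleC lee_wpmul2r // lee_fin.
exact: (@block (w, x) Gwx).
Qed.

(** The tail probabilities decrease geometrically along steps of length H. *)
Lemma expected_self_intersection_time :
  (\int[P]_w self_intersection_time R X w <= (1 + H%:R / p)%:E)%E.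
Proof.
have mS := measurable_no_hit_event.
under eq_integral do rewrite self_intersection_time_series.
pose f t (w : Omega) := (\1_(no_hit_event t) w)%:E : \bar R.
rewrite (eq_integral (fun w => \sum_(0 <= t <oo) f t w)%E); last first.
  move=> w _; congr (limn _); apply/funext => N; apply: eq_bigr => t _.
  by rewrite /f indicE; congr (_%:R%:E); rewrite mem_setE.
rewrite integral_nneseries //; last 2 first.
- by move=> t; apply/measurable_EFinP; exact: measurable_indic.
- by move=> t w _; rewrite lee_fin.
have fE t : (\int[P]_w f t w = P (no_hit_event t))%E.
  by rewrite integral_indic // setIT.
pose a t := fine (P (no_hit_event t.+1)).
have PE t : P (no_hit_event t) = (fine (P (no_hit_event t)))%:E.
  by rewrite fineK // fin_num_measure.
have a1 t : fine (P (no_hit_event t)) <= 1.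
  by rewrite -lee_fin -PE probability_le1.
apply: nneseries_le_bound => [t|N]; first by rewrite fE.
apply: (@le_trans _ _ (\sum_(t < N.+1) P (no_hit_event t))%E).
  by rewrite big_ord_recr /= (eq_bigr _ (fun t _ => fE _)) leeDl.
under eq_bigr do rewrite PE.
rewrite sumEFin lee_fin big_ord_recl lerD ?a1 //.
apply: (@contracting_sum_le _ a) => // t; rewrite /a ?fine_ge0 //.
by rewrite -lee_fin EFinM -!PE -addSn no_hit_block_contraction.
Qed.

End ExpectedTime.

(** * Choice of the block length *)

Theorem theorem2 (R : realType) (Delta : nat) (eps : R)
    (hDelta : (3 <= Delta)%N) (heps : 0 < eps) :
  exists C : R,
    forall (V : finType) (G : sgraph V) (u : V),
      connected_graph G -> regular_graph G Delta ->
      second_eigenvalue R G Delta <= Delta%:R - eps ->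
    forall (d : measure_display) (Omega : measurableType d)
      (P : probability Omega R) (X : nat -> Omega -> V),
      is_nbw G u P X ->
      (\int[P]_w self_intersection_time R X w
         <= (C * Num.sqrt #|V|%:R)%:E)%E.
Proof.
pose theta : R := Num.min eps 1 / Delta%:R.
have D3 : 3 <= Delta%:R :> R by rewrite ler_nat.
have e0 : 0 < Num.min eps 1 by rewrite lt_min heps ltr01.
have e1 : Num.min eps 1 <= 1 by rewrite ge_min lexx orbT.
have e2 : Num.min eps 1 <= eps by rewrite ge_min lexx.
have th0 : 0 < theta by rewrite divr_gt0 //; lra.
have th1 : theta <= 1 by rewrite ler_pdivrMr; lra.
pose A : R := 48 / theta; pose tau : R := 1 - 3 * theta / 64.
have A48 : 48 <= A by rewrite ler_pdivlMr //; lra.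
have tau0 : 0 < tau by rewrite /tau; lra.
have tau1 : tau < 1 by rewrite /tau; lra.
pose p := (4 * second_moment_const A tau)^-1.
have p0 : 0 < p.
  by rewrite invr_gt0 mulr_gt0 // second_moment_const_gt0 //; lra.
(* M makes the mixing condition on L hold: by [nat_mul_expr_le], L * tau ^ L is at
   most 1 / (1 - tau), so that tau ^ (2 L) is at most of order 1 / L ^ 2, and
   L ^ 2 >= M n suffices. *)
pose M : R := 16 * A / (1 - tau) ^+ 2.
pose K := (Num.truncn M).+1.
have MK : M <= K%:R ^+ 2.
  have h1 : 1 <= K%:R :> R by rewrite ler1n.
  have h2 : M <= K%:R by rewrite ltW // truncnS_gt.
  by apply: le_trans h2 _; rewrite expr2 ler_peMl //; lra.
exists (1 + 12 * K%:R / p) => V G u Gconn Greg gap d Omega P X Xnbw.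
set n : R := #|V|%:R; pose s := Num.sqrt n.
have n1 : 1 <= n by rewrite ler1n; apply/card_gt0P; exists u.
have s1 : 1 <= s by rewrite -sqrtr1 ler_wsqrtr.
have s2 : s ^+ 2 = n by rewrite sqr_sqrtr //; lra.
pose m := (Num.truncn s).+1; pose L := (K * m)%N.
have sm : s <= m%:R by rewrite ltW // truncnS_gt.
have ms : m%:R <= 2 * s.
  have /truncn_itv/andP[h _] : 0 <= s by lra.
  rewrite /m -addn1 natrD; lra.
have L_large : K%:R ^+ 2 * n <= L%:R ^+ 2.
  rewrite natrM exprMn ler_wpM2l ?sqr_ge0 // -s2.
  by rewrite !expr2 ler_pM //; lra.
have [J [mu [v [v_eig v_frame v_gap]]]] := spectral_gap_frame Greg gap.
(* Replacing eps by its minimum with 1 keeps theta at most 1, and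
   (Delta - eps) ^ 2 <= Delta ^ 2 - Delta eps for eps <= Delta. *)
have theta_gap j : `|mu j| != Delta%:R -> mu j ^+ 2 <= Delta%:R ^+ 2 * (1 - theta).
  move=> /v_gap muj; have -> : Delta%:R ^+ 2 * (1 - theta) =
      Delta%:R ^+ 2 - Delta%:R * Num.min eps 1.
    by rewrite /theta; field; rewrite gt_eqF //; lra.
  have m0 := normr_ge0 (mu j).
  rewrite -[mu j ^+ 2]real_normK ?num_real //.
  have : `|mu j| ^+ 2 <= (Delta%:R - Num.min eps 1) ^+ 2.
    by rewrite !expr2 ler_pM //; lra.
  have : 0 <= Num.min eps 1 * (Delta%:R - Num.min eps 1) by rewrite mulr_ge0 //; lra.
  by rewrite sqrrB; lra.
have block e : G e.1 e.2 ->
    nbw_exp G Delta (6 * L) e (fun l => (uniq (e.2 :: l))%:R) <= 1 - p.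
  move=> Ge; apply: (@block_uniq_ub R V G Delta) => //.
  - lra.
  - move=> k x y; apply: le_trans
      (nbw_kernel_ub Greg hDelta Gconn v_eig v_frame th0 th1 theta_gap k x y) _.
    by rewrite lerD2r ler_wpM2r ?invr_ge0; lra.
  - exact: (nbw_kernel_sym Greg hDelta v_eig v_frame).
  - exact: (nbw_return_lb Greg hDelta Gconn v_eig v_frame th0 th1 theta_gap).
  - rewrite -[leRHS]mul1r ler_pdivlMr -/n; last lra.
    have := nat_mul_expr_le L (ltW tau0) tau1.
    rewrite mulnC exprM; set z := tau ^+ L => hz.
    have t1 : 0 < 1 - tau by rewrite subr_gt0.
    have z0 : 0 <= z by rewrite exprn_ge0 // ltW.
    have Lz : (L%:R * z * (1 - tau)) ^+ 2 <= 1.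
      by rewrite exprn_ile1 ?mulr_ge0 ?(ltW t1) // -ler_pdivlMr // mul1r.
    apply: le_trans Lz; rewrite !exprMn.
    have h1 : 16 * A <= K%:R ^+ 2 * (1 - tau) ^+ 2 by rewrite -ler_pdivrMr ?exprn_gt0.
    have n0 : 0 <= n by lra.
    have h2 := ler_wpM2r n0 h1.
    have h3 : K%:R ^+ 2 * (1 - tau) ^+ 2 * n <= L%:R ^+ 2 * (1 - tau) ^+ 2.
      by rewrite mulrAC ler_wpM2r ?sqr_ge0.
    have := ler_wpM2r (sqr_ge0 z) (le_trans h2 h3); lra.
  - apply: le_trans L_large; rewrite ler_peMl //.
    by rewrite exprn_ege1 // ler1n.
apply: le_trans (expected_self_intersection_time Greg Xnbw p0 block) _.
have pV : 0 <= p^-1 := ltW (etrans (invr_gt0 p) p0).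
rewrite lee_fin mulrDl mul1r lerD // [leRHS]mulrAC ler_wpM2r //.
rewrite !natrM -/s; have : K%:R * m%:R <= K%:R * (2 * s) by rewrite ler_wpM2l.
lra.
Qed.
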